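(* Let $(A_\lambda)_{\lambda\in\Lambda}$ be a family of approximately semi-contractible (respectively, approximately semi-amenable) Banach algebras. Then $\ell^p(A_\lambda)$ (for $1\le p<\infty$) and $c_0(A_\lambda)$ are approximately semi-contractible (respectively, approximately semi-amenable).
   Context: $c_0(A_\lambda)$ is the Banach algebra of families $a=(a_\lambda)$ with $a_\lambda\in A_\lambda$ and $\|a_\lambda\|\to0$ at infinity, with coordinatewise operations and norm $\sup_\lambda\|a_\lambda\|$; $\ell^p(A_\lambda)$ consists of families with $\sum_\lambda\|a_\lambda\|^p<\infty$, coordinatewise operations and norm $(\sum_\lambda\|a_\lambda\|^p)^{1/p}$. For a Banach algebra $C$ and Banach $C$-bimodule $Y$, a derivation is a linear $D:C\to Y$ with $D(ab)=a\cdot D(b)+D(a)\cdot b$; a continuous derivation is approximately semi-inner if there are nets $(\xi_i),(\eta_i)$ in $Y$ with $D(a)=\lim_i(a\cdot\xi_i-\eta_i\cdot a)$ in norm for every $a\in C$. $C$ is approximately semi-contractible if for every Banach $C$-bimodule $Y$ every continuous derivation $C\to Y$ is approximately semi-inner, and approximately semi-amenable if for every Banach $C$-bimodule $X$ every continuous derivation $C\to X^*$ is approximately semi-inner ($X^*$ with the dual module structure). *)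

(* Defs.v *)
From HB Require Import structures.
From mathcomp Require Import all_boot all_order all_algebra.
From mathcomp Require Import all_classical all_reals all_analysis.
From mathcomp Require complex.
Import complex.ComplexField.

Set Implicit Arguments.
Unset Strict Implicit.
Unset Printing Implicit Defensive.
Import Order.TTheory GRing.Theory Num.Theory.
Local Open Scope classical_set_scope.
Local Open Scope ring_scope.

Notation Cx R := (complex.complex R).

Definition cmod {R : realType} (z : Cx R) : R :=
  Num.sqrt (complex.Re z ^+ 2 + complex.Im z ^+ 2).

Record nspace (R : realType) := NSpace {
  ns_car :> Type;
  ns_zero : ns_car;
  ns_add : ns_car -> ns_car -> ns_car;
  ns_opp : ns_car -> ns_car;
  ns_scale : Cx R -> ns_car -> ns_car;
  ns_norm : ns_car -> R }.

Definition ns_sub {R : realType} (V : nspace R) (x y : V) : V :=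
  ns_add x (ns_opp y).

Record nalg (R : realType) := NAlg {
  na_sp :> nspace R;
  na_mul : na_sp -> na_sp -> na_sp }.

Definition is_banach_space {R : realType} (V : nspace R) (S : set V) : Prop :=
  ((S (ns_zero V)) /\
      ((forall x y, S x -> S y -> S (ns_add x y))) /\
      ((forall x, S x -> S (ns_opp x))) /\
      ((forall k x, S x -> S (ns_scale k x))) /\
      ((forall x y z, S x -> S y -> S z ->
          ns_add x (ns_add y z) = ns_add (ns_add x y) z)) /\
      ((forall x y, S x -> S y -> ns_add x y = ns_add y x)) /\
      ((forall x, S x -> ns_add (ns_zero V) x = x)) /\
      ((forall x, S x -> ns_add x (ns_opp x) = ns_zero V)) /\
      ((forall k l x, S x -> ns_scale k (ns_scale l x) = ns_scale (k * l) x)) /\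
      ((forall x, S x -> ns_scale 1 x = x)) /\
      ((forall k x y, S x -> S y ->
          ns_scale k (ns_add x y) = ns_add (ns_scale k x) (ns_scale k y))) /\
      ((forall k l x, S x ->
          ns_scale (k + l) x = ns_add (ns_scale k x) (ns_scale l x))) /\
      ((forall x, S x -> 0 <= ns_norm x)) /\
      ((forall x, S x -> ns_norm x = 0 -> x = ns_zero V)) /\
      ((forall k x, S x -> ns_norm (ns_scale k x) = cmod k * ns_norm x)) /\
      ((forall x y, S x -> S y -> ns_norm (ns_add x y) <= ns_norm x + ns_norm y)) /\
      (
      (forall u : nat -> V, (forall n, S (u n)) ->
         (forall e : R, 0 < e -> exists N, forall m n, (N <= m)%N -> (N <= n)%N ->
              ns_norm (ns_sub (u m) (u n)) < e) ->
         exists2 x, S x & forall e : R, 0 < e -> exists N, forall n, (N <= n)%N ->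
              ns_norm (ns_sub (u n) x) < e))).

Definition is_banach_algebra {R : realType} (A : nalg R) (S : set A) : Prop :=
  ((@is_banach_space R A S) /\
      ((forall x y, S x -> S y -> S (na_mul x y))) /\
      ((forall x y z, S x -> S y -> S z ->
          na_mul x (na_mul y z) = na_mul (na_mul x y) z)) /\
      ((forall x y z, S x -> S y -> S z ->
          na_mul x (ns_add y z) = ns_add (na_mul x y) (na_mul x z))) /\
      ((forall x y z, S x -> S y -> S z ->
          na_mul (ns_add x y) z = ns_add (na_mul x z) (na_mul y z))) /\
      ((forall k x y, S x -> S y ->
          na_mul (ns_scale k x) y = ns_scale k (na_mul x y))) /\
      ((forall k x y, S x -> S y ->
          na_mul x (ns_scale k y) = ns_scale k (na_mul x y))) /\
      ((forall x y, S x -> S y -> ns_norm (na_mul x y) <= ns_norm x * ns_norm y))).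

Record bimod {R : realType} (A : nalg R) := BiMod {
  bm_sp :> nspace R;
  bm_l : A -> bm_sp -> bm_sp;
  bm_r : bm_sp -> A -> bm_sp }.

Definition is_banach_bimodule {R : realType} (A : nalg R) (S : set A)
    (Y : bimod A) : Prop :=
  ((@is_banach_space R Y setT) /\
      ((forall a b (y : Y), S a -> S b -> bm_l (na_mul a b) y = bm_l a (bm_l b y))) /\
      ((forall a b (y : Y), S a -> S b -> bm_r y (na_mul a b) = bm_r (bm_r y a) b)) /\
      ((forall a b (y : Y), S a -> S b -> bm_r (bm_l a y) b = bm_l a (bm_r y b))) /\
      ((forall a b (y : Y), S a -> S b -> bm_l (ns_add a b) y = ns_add (bm_l a y) (bm_l b y))) /\
      ((forall a b (y : Y), S a -> S b -> bm_r y (ns_add a b) = ns_add (bm_r y a) (bm_r y b))) /\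
      ((forall a (y z : Y), S a -> bm_l a (ns_add y z) = ns_add (bm_l a y) (bm_l a z))) /\
      ((forall a (y z : Y), S a -> bm_r (ns_add y z) a = ns_add (bm_r y a) (bm_r z a))) /\
      ((forall k a (y : Y), S a -> bm_l (ns_scale k a) y = ns_scale k (bm_l a y))) /\
      ((forall k a (y : Y), S a -> bm_r y (ns_scale k a) = ns_scale k (bm_r y a))) /\
      ((forall k a (y : Y), S a -> bm_l a (ns_scale k y) = ns_scale k (bm_l a y))) /\
      ((forall k a (y : Y), S a -> bm_r (ns_scale k y) a = ns_scale k (bm_r y a))) /\
      ((exists M : R, forall a (y : Y), S a ->
          ns_norm (bm_l a y) <= M * ns_norm a * ns_norm y /\
          ns_norm (bm_r y a) <= M * ns_norm a * ns_norm y))).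

Definition directed {I : Type} (le : I -> I -> Prop) : Prop :=
  (((exists i : I, True)) /\
      ((forall i, le i i)) /\
      ((forall i j k, le i j -> le j k -> le i k)) /\
      ((forall i j, exists k, le i k /\ le j k))).

Definition net_to0 {R : realType} {I : Type} (le : I -> I -> Prop) (u : I -> R) : Prop :=
  forall e : R, 0 < e -> exists i0, forall i, le i0 i -> `|u i| < e.

Definition is_cont_derivation {R : realType} (A : nalg R) (S : set A)
    (Y : bimod A) (D : A -> Y) : Prop :=
  (((forall a b, S a -> S b -> D (ns_add a b) = ns_add (D a) (D b))) /\
      ((forall k a, S a -> D (ns_scale k a) = ns_scale k (D a))) /\
      ((forall a b, S a -> S b ->
          D (na_mul a b) = ns_add (bm_l a (D b)) (bm_r (D a) b))) /\
      ((forall a, S a -> forall e : R, 0 < e -> exists2 d : R, 0 < d &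
          forall b, S b -> ns_norm (ns_sub b a) < d ->
             ns_norm (ns_sub (D b) (D a)) < e))).

Definition approx_semi_inner {R : realType} (A : nalg R) (S : set A)
    (Y : bimod A) (D : A -> Y) : Prop :=
  exists (I : Type) (le : I -> I -> Prop) (xi eta : I -> Y),
    directed le /\
    forall a, S a ->
      net_to0 le (fun i => ns_norm (ns_sub (D a) (ns_sub (bm_l a (xi i)) (bm_r (eta i) a)))).

Definition approx_semi_contractible {R : realType} (A : nalg R) (S : set A) : Prop :=
  forall (Y : bimod A), is_banach_bimodule S Y ->
  forall D : A -> Y, is_cont_derivation S D -> approx_semi_inner S D.

Definition is_bdd_functional {R : realType} (X : nspace R) (f : X -> Cx R) : Prop :=
  (((forall x y, f (ns_add x y) = f x + f y)) /\
      ((forall k x, f (ns_scale k x) = k * f x)) /\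
      ((exists M : R, forall x, cmod (f x) <= M * ns_norm x))).

Definition dual_norm {R : realType} (X : nspace R) (f : X -> Cx R) : R :=
  sup [set cmod (f x) | x in [set x : X | ns_norm x <= 1]].

(** Continuous derivations [S -> X^*] where X^* carries the dual module
    structure: (a.f)(x) = f(x.a), (f.a)(x) = f(a.x). *)
Definition is_cont_derivation_dual {R : realType} (A : nalg R) (S : set A)
    (X : bimod A) (D : A -> X -> Cx R) : Prop :=
  (((forall a, S a -> is_bdd_functional (D a))) /\
      ((forall a b x, S a -> S b -> D (ns_add a b) x = D a x + D b x)) /\
      ((forall k a x, S a -> D (ns_scale k a) x = k * D a x)) /\
      ((forall a b x, S a -> S b ->
          D (na_mul a b) x = D b (bm_r x a) + D a (bm_l b x))) /\
      ((forall a, S a -> forall e : R, 0 < e -> exists2 d : R, 0 < d &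
          forall b, S b -> ns_norm (ns_sub b a) < d ->
             dual_norm (fun x => D b x - D a x) < e))).

Definition approx_semi_inner_dual {R : realType} (A : nalg R) (S : set A)
    (X : bimod A) (D : A -> X -> Cx R) : Prop :=
  exists (I : Type) (le : I -> I -> Prop) (xi eta : I -> X -> Cx R),
    ((directed le) /\
      ((forall i, is_bdd_functional (xi i))) /\
      ((forall i, is_bdd_functional (eta i))) /\
    (forall a, S a ->
          net_to0 le (fun i => dual_norm
             (fun x => D a x - (xi i (bm_r x a) - eta i (bm_l a x)))))).

Definition approx_semi_amenable {R : realType} (A : nalg R) (S : set A) : Prop :=
  forall (X : bimod A), is_banach_bimodule S X ->
  forall D : A -> X -> Cx R, is_cont_derivation_dual S D -> approx_semi_inner_dual S D.

(** Direct-sum constructions over a family (A_l)_{l in L}.  Both are realized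
    inside the ambient type of all families [forall l, A l] with coordinatewise
    operations; the subsets [lp_set] / [c0_set] single out l^p(A_l) / c_0(A_l). *)
Section Families.
Context {R : realType} {L : choiceType} (A : L -> nalg R).

Definition fam_sp (nrm : (forall l, A l) -> R) : nspace R :=
  @NSpace R (forall l, A l)
    (fun l => ns_zero (A l))
    (fun a b l => ns_add (a l) (b l))
    (fun a l => ns_opp (a l))
    (fun k a l => ns_scale k (a l))
    nrm.

Definition fam_alg (nrm : (forall l, A l) -> R) : nalg R :=
  @NAlg R (fam_sp nrm) (fun a b l => na_mul (a l) (b l)).

Definition lp_sum (p : R) (a : forall l, A l) : \bar R :=
  (\esum_(l in setT) ((ns_norm (a l)) `^ p)%:E)%E.

Definition lp_norm (p : R) (a : forall l, A l) : R :=
  (fine (lp_sum p a)) `^ (p^-1).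

Definition lp_set (p : R) : set (fam_alg (lp_norm p)) :=
  [set a | (lp_sum p a < +oo)%E].

Definition lp_alg (p : R) : nalg R := fam_alg (lp_norm p).

Definition c0_norm (a : forall l, A l) : R :=
  sup [set ns_norm (a l) | l in setT].

Definition c0_set : set (fam_alg c0_norm) :=
  [set a | forall e : R, 0 < e -> finite_set [set l | e <= ns_norm (a l)]].

Definition c0_alg : nalg R := fam_alg c0_norm.

End Families.

Arguments is_banach_algebra {R} A S.
Arguments approx_semi_contractible {R} A S.
Arguments approx_semi_amenable {R} A S.
Arguments lp_set {R L} A p.
Arguments lp_alg {R L} A p.
Arguments c0_set {R L} A.
Arguments c0_alg {R L} A.

(* Main.v *)
Require Import Defs.
From Stdlib Require List.
From mathcomp Require Import all_boot all_order all_algebra.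
From mathcomp Require Import all_classical all_reals all_analysis.
From mathcomp Require Import ring lra.
From mathcomp Require complex.
Import complex.ComplexField numFieldNormedType.Exports.
Import Order.TTheory GRing.Theory Num.Theory.
Local Open Scope classical_set_scope.
Local Open Scope ring_scope.

Set Implicit Arguments.
Unset Strict Implicit.
Unset Printing Implicit Defensive.

(** Approximate semi-innerness only has to be checked on finitely many elements
    [a] at a time.  Given these, cut them to a finite set of coordinates, which
    moves [D a] little by continuity, and choose for each coordinate [l] elements
    [xi_l], [eta_l] that implement [D] on [A l].  Semi-contractibility of [A l]
    also yields one-sided approximate units (apply it to the identity map into
    [A] with one action made trivial); replacing [xi_l] by [e . xi_l] and [eta_l]
    by [eta_l . f] with [e], [f] in [A l] changes nothing essential on [A l] but
    makes them annihilated by all other coordinates, so that their sums over [l]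
    work for the whole algebra, including elements of infinite support.  In the
    semi-amenable case the approximate units live in the bidual of [A l], and act
    on [X^*] by [(E . xi) (x) = E (c |-> xi (x . c))]. *)

(** * Modulus, limits and completeness in the complex numbers *)

Section ComplexModulus.
Context {R : realType}.
Implicit Types (z w : Cx R).

Lemma cmod_ge0 z : 0 <= cmod z.
Proof. exact: sqrtr_ge0. Qed.

Lemma cmod0 : cmod (0 : Cx R) = 0.
Proof. by rewrite /cmod /= expr0n/= addr0 sqrtr0. Qed.

Lemma cmod1 : cmod (1 : Cx R) = 1.
Proof. by rewrite /cmod /= expr0n/= addr0 expr1n sqrtr1. Qed.

Lemma cmodN z : cmod (- z) = cmod z.
Proof. by case: z => a b; rewrite /cmod /= !sqrrN. Qed.

Lemma cmodM z w : cmod (z * w) = cmod z * cmod w.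
Proof. by have := Normc.normcM z w; case: z w => a b [c d]. Qed.

Lemma cmodD z w : cmod (z + w) <= cmod z + cmod w.
Proof. by have := complex.le_normcD z w; case: z w => a b [c d]. Qed.

Lemma cmod_real (r : R) : cmod (complex.Complex r 0) = `|r|.
Proof. by rewrite /cmod /= expr0n addr0 sqrtr_sqr. Qed.

Lemma cmod_eq0 z : cmod z = 0 -> z = 0.
Proof.
case: z => a b /eqP; rewrite sqrtr_eq0 /= => ab; suff [-> ->] : a = 0 /\ b = 0 by [].
by have /= := sqr_ge0 a; have /= := sqr_ge0 b; split; nra.
Qed.

Lemma Re_le_cmod z : `|complex.Re z| <= cmod z.
Proof. by rewrite -sqrtr_sqr ler_wsqrtr// lerDl sqr_ge0. Qed.

Lemma Im_le_cmod z : `|complex.Im z| <= cmod z.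
Proof. by rewrite -sqrtr_sqr ler_wsqrtr// lerDr sqr_ge0. Qed.

Lemma cmod_le_Re_Im z : cmod z <= `|complex.Re z| + `|complex.Im z|.
Proof.
rewrite -(ger0_norm (addr_ge0 (normr_ge0 _) (normr_ge0 _))) -sqrtr_sqr.
rewrite ler_wsqrtr// sqrrD !real_normK ?num_real// -addrA lerD2l lerDr.
by rewrite mulrn_wge0// mulr_ge0.
Qed.

Lemma cmodB z w : cmod (z - w) = cmod (w - z).
Proof. by rewrite -cmodN opprB. Qed.

(** Translates the filter form of completeness into the epsilon form used by [is_banach_space]. *)
Lemma real_cauchy_cvg (u : nat -> R) :
  (forall e : R, 0 < e -> exists N, forall m n, (N <= m)%N -> (N <= n)%N ->
     `|u m - u n| < e) ->
  exists l, forall e : R, 0 < e -> exists N, forall n, (N <= n)%N -> `|u n - l| < e.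
Proof.
move=> h; have : cvg (u @ \oo).
  apply/cauchy_cvgP/cauchy_exP => e e0; have [N hN] := h e e0.
  by exists (u N); exists N => // n /= Nn; rewrite /ball/=; exact: hN.
move=> /cvgrPdist_lt cu; exists (lim (u @ \oo)) => e /cu[N _ hN].
by exists N => n Nn; rewrite distrC; exact: hN.
Qed.

Lemma cx_cauchy_cvg (u : nat -> Cx R) :
  (forall e : R, 0 < e -> exists N, forall m n, (N <= m)%N -> (N <= n)%N ->
     cmod (u m - u n) < e) ->
  exists l, forall e : R, 0 < e -> exists N, forall n, (N <= n)%N -> cmod (u n - l) < e.
Proof.
have ReB z w : complex.Re (z - w) = complex.Re z - complex.Re w by case: z w => ? ? [].
have ImB z w : complex.Im (z - w) = complex.Im z - complex.Im w by case: z w => ? ? [].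
move=> h.
have [a ha] : exists a, forall e : R, 0 < e ->
    exists N, forall n, (N <= n)%N -> `|complex.Re (u n) - a| < e.
  apply: real_cauchy_cvg => e /h[N hN]; exists N => m n Nm Nn.
  by rewrite -ReB; apply: le_lt_trans (Re_le_cmod _) _; exact: hN.
have [b hb] : exists b, forall e : R, 0 < e ->
    exists N, forall n, (N <= n)%N -> `|complex.Im (u n) - b| < e.
  apply: real_cauchy_cvg => e /h[N hN]; exists N => m n Nm Nn.
  by rewrite -ImB; apply: le_lt_trans (Im_le_cmod _) _; exact: hN.
exists (complex.Complex a b) => e e0.
have e20 : 0 < e / 2 by rewrite divr_gt0.
have [N1 h1] := ha _ e20; have [N2 h2] := hb _ e20.
exists (maxn N1 N2) => n; rewrite geq_max => /andP[/h1 n1 /h2 n2].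
apply: le_lt_trans (cmod_le_Re_Im _) _; rewrite ReB ImB /=; lra.
Qed.

Lemma cmod_lim_le (u : nat -> Cx R) (l z : Cx R) (c : R) (N : nat) :
  (forall e : R, 0 < e -> exists N, forall n, (N <= n)%N -> cmod (u n - l) < e) ->
  (forall n, (N <= n)%N -> cmod (u n - z) <= c) -> cmod (l - z) <= c.
Proof.
move=> ul uz; apply/ler_addgt0Pr => e /ul[M hM].
have h1 := hM (maxn M N) (leq_maxl _ _); have h2 := uz (maxn M N) (leq_maxr _ _).
have -> : l - z = (u (maxn M N) - z) + - (u (maxn M N) - l) by ring.
by apply: le_trans (cmodD _ _) _; rewrite cmodN; lra.
Qed.

Lemma cmod_small_eq z w : (forall e : R, 0 < e -> cmod (z - w) <= e) -> z = w.
Proof.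
move=> h; apply/subr0_eq/cmod_eq0/eqP.
rewrite eq_le cmod_ge0 andbT; apply/ler_addgt0Pr => e e0.
by rewrite add0r; exact: h.
Qed.

End ComplexModulus.

(** * Elementary calculus in a Banach space filling its whole carrier *)

Section BanachSpace.
Context {R : realType} {V : nspace R} (hV : @is_banach_space R V setT).
Implicit Types (x y z : V).

Lemma ns_addA x y z : ns_add x (ns_add y z) = ns_add (ns_add x y) z.
Proof. by case: hV => _ [_ [_ [_ [h _]]]]; exact: h. Qed.

Lemma ns_addC x y : ns_add x y = ns_add y x.
Proof. by case: hV => _ [_ [_ [_ [_ [h _]]]]]; exact: h. Qed.

Lemma ns_add0 x : ns_add (ns_zero V) x = x.
Proof. by case: hV => _ [_ [_ [_ [_ [_ [h _]]]]]]; exact: h. Qed.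

Lemma ns_addN x : ns_add x (ns_opp x) = ns_zero V.
Proof. by case: hV => _ [_ [_ [_ [_ [_ [_ [h _]]]]]]]; exact: h. Qed.

Lemma ns_scaleA k l x : ns_scale k (ns_scale l x) = ns_scale (k * l) x.
Proof. by case: hV => _ [_ [_ [_ [_ [_ [_ [_ [h _]]]]]]]]; exact: h. Qed.

Lemma ns_scale1 x : ns_scale 1 x = x.
Proof. by case: hV => _ [_ [_ [_ [_ [_ [_ [_ [_ [h _]]]]]]]]]; exact: h. Qed.

Lemma ns_scaleDl k l x : ns_scale (k + l) x = ns_add (ns_scale k x) (ns_scale l x).
Proof.
by case: hV => _ [_ [_ [_ [_ [_ [_ [_ [_ [_ [_ [h _]]]]]]]]]]]; exact: h.
Qed.

Lemma ns_norm_ge0 x : 0 <= ns_norm x.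
Proof.
by case: hV => _ [_ [_ [_ [_ [_ [_ [_ [_ [_ [_ [_ [h _]]]]]]]]]]]]; exact: h.
Qed.

Lemma ns_norm_eq0 x : ns_norm x = 0 -> x = ns_zero V.
Proof.
by case: hV => _ [_ [_ [_ [_ [_ [_ [_ [_ [_ [_ [_ [_ [h _]]]]]]]]]]]]]; exact: h.
Qed.

Lemma ns_normZ k x : ns_norm (ns_scale k x) = cmod k * ns_norm x.
Proof.
by case: hV => _ [_ [_ [_ [_ [_ [_ [_ [_ [_ [_ [_ [_ [_ [h _]]]]]]]]]]]]]]; exact: h.
Qed.

Lemma ns_normD x y : ns_norm (ns_add x y) <= ns_norm x + ns_norm y.
Proof.
by case: hV => _ [_ [_ [_ [_ [_ [_ [_ [_ [_ [_ [_ [_ [_ [_ [h _]]]]]]]]]]]]]]]; exact: h.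
Qed.

Lemma ns_addIl x y z : ns_add x y = ns_add x z -> y = z.
Proof.
move=> /(congr1 (ns_add (ns_opp x))).
by rewrite !ns_addA (ns_addC (ns_opp x)) ns_addN !ns_add0.
Qed.

Lemma ns_addr0 x : ns_add x (ns_zero V) = x.
Proof. by rewrite ns_addC ns_add0. Qed.

(** Serves to show that additive maps preserve zero. *)
Lemma ns_idem_eq0 x : ns_add x x = x -> x = ns_zero V.
Proof. by move=> h; apply: (@ns_addIl x); rewrite h ns_addr0. Qed.

Lemma ns_addACA x y z t :
  ns_add (ns_add x y) (ns_add z t) = ns_add (ns_add x z) (ns_add y t).
Proof. by rewrite -!ns_addA (ns_addA y) (ns_addC y z) -!ns_addA. Qed.

Lemma ns_oppD x y : ns_opp (ns_add x y) = ns_add (ns_opp x) (ns_opp y).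
Proof.
apply: (@ns_addIl (ns_add x y)).
by rewrite ns_addN ns_addACA !ns_addN ns_add0.
Qed.

Lemma ns_oppK x : ns_opp (ns_opp x) = x.
Proof. by apply: (@ns_addIl (ns_opp x)); rewrite ns_addN ns_addC ns_addN. Qed.

Lemma ns_opp0 : ns_opp (ns_zero V) = ns_zero V.
Proof. by rewrite -[LHS]ns_add0 ns_addN. Qed.

Lemma ns_sub0 x : ns_sub x (ns_zero V) = x.
Proof. by rewrite /ns_sub ns_opp0 ns_addr0. Qed.

Lemma ns_scale0 x : ns_scale 0 x = ns_zero V.
Proof. by apply: ns_idem_eq0; rewrite -ns_scaleDl addr0. Qed.

Lemma ns_scaleN1 x : ns_scale (- 1) x = ns_opp x.
Proof.
apply: (@ns_addIl x); rewrite ns_addN -{1}(ns_scale1 x) -ns_scaleDl.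
by rewrite subrr ns_scale0.
Qed.

Lemma ns_normN x : ns_norm (ns_opp x) = ns_norm x.
Proof. by rewrite -ns_scaleN1 ns_normZ cmodN cmod1 mul1r. Qed.

Lemma ns_norm0 : ns_norm (ns_zero V) = 0.
Proof.
by rewrite -(ns_scale0 (ns_zero V)) ns_normZ cmod0 mul0r.
Qed.

Lemma ns_subDD x y z t :
  ns_sub (ns_add x y) (ns_add z t) = ns_add (ns_sub x z) (ns_sub y t).
Proof. by rewrite /ns_sub ns_oppD ns_addACA. Qed.

Lemma ns_dist_tri y x z :
  ns_norm (ns_sub x z) <= ns_norm (ns_sub x y) + ns_norm (ns_sub y z).
Proof.
apply: le_trans (ns_normD _ _); rewrite /ns_sub -ns_addA (ns_addA (ns_opp y)).
by rewrite (ns_addC (ns_opp y)) ns_addN ns_add0.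
Qed.

Lemma ns_distC x y : ns_norm (ns_sub x y) = ns_norm (ns_sub y x).
Proof. by rewrite /ns_sub -ns_normN ns_oppD ns_oppK ns_addC. Qed.

Lemma ns_distD x y z t : ns_norm (ns_sub (ns_add x y) (ns_add z t)) <=
  ns_norm (ns_sub x z) + ns_norm (ns_sub y t).
Proof. by rewrite ns_subDD; exact: ns_normD. Qed.

Lemma ns_distB x y z t : ns_norm (ns_sub (ns_sub x y) (ns_sub z t)) <=
  ns_norm (ns_sub x z) + ns_norm (ns_sub y t).
Proof.
apply: le_trans (ns_distD _ _ _ _) _.
rewrite lerD2l -[leRHS]ns_normN.
by rewrite /ns_sub ns_oppD.
Qed.

End BanachSpace.

(** * Bounded functionals and the dual space *)

Section DualSpace.
Context {R : realType} {X : nspace R}.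
Implicit Types (f g : X -> Cx R).

Lemma bdd_zero : is_bdd_functional (fun _ : X => 0 : Cx R).
Proof.
split=> [x y|]; first by rewrite addr0.
split=> [k x|]; first by rewrite mulr0.
by exists 0 => x; rewrite cmod0 mul0r.
Qed.

Lemma bdd_add f g : is_bdd_functional f -> is_bdd_functional g ->
  is_bdd_functional (fun x => f x + g x).
Proof.
move=> [fD [fZ [M fM]]] [gD [gZ [N gN]]].
split=> [x y|]; first by rewrite fD gD; ring.
split=> [k x|]; first by rewrite fZ gZ; ring.
exists (M + N) => x; apply: le_trans (cmodD _ _) _.
by rewrite mulrDl lerD.
Qed.

Lemma bdd_scale k f : is_bdd_functional f -> is_bdd_functional (fun x => k * f x).
Proof.
move=> [fD [fZ [M fM]]].
split=> [x y|]; first by rewrite fD; ring.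
split=> [l x|]; first by rewrite fZ; ring.
exists (cmod k * M) => x; rewrite cmodM -mulrA.
by apply: ler_wpM2l; [exact: cmod_ge0 | exact: fM].
Qed.

Lemma bdd_opp f : is_bdd_functional f -> is_bdd_functional (fun x => - f x).
Proof.
move=> hf; have -> : (fun x => - f x) = (fun x => (- 1) * f x).
  by apply/funext => x; ring.
exact: bdd_scale.
Qed.

Lemma bdd_bound f : is_bdd_functional f -> (forall x : X, 0 <= ns_norm x) ->
  exists2 M : R, 0 <= M & forall x, cmod (f x) <= M * ns_norm x.
Proof.
move=> [_ [_ [M fM]]] n0; exists `|M| => // x.
by apply: le_trans (fM x) _; rewrite ler_wpM2r// ler_norm.
Qed.

(** Boundedness is bundled because a Banach bimodule has to satisfy the Banach space axioms on its
    entire carrier. *)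
Record bfun := BFun { bf_fun :> X -> Cx R ; bf_bdd : is_bdd_functional bf_fun }.

Lemma bfun_ext (f g : bfun) : (forall x, f x = g x) -> f = g.
Proof.
case: f g => [f hf] [g hg] /= /funext fg; rewrite -fg in hg *.
by rewrite (Prop_irrelevance hf hg).
Qed.

(* Unbounded or nonlinear maps are sent to [0], so that the module actions on
   the dual are total. *)
Definition to_bfun f : bfun :=
  if pselect (is_bdd_functional f) is left h then BFun h else BFun bdd_zero.

Lemma to_bfunE f x : is_bdd_functional f -> to_bfun f x = f x.
Proof. by rewrite /to_bfun; case: pselect. Qed.

Definition dual_sp : nspace R := @NSpace R bfun
  (BFun bdd_zero)
  (fun f g : bfun => BFun (bdd_add (bf_bdd f) (bf_bdd g)))
  (fun f : bfun => BFun (bdd_opp (bf_bdd f)))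
  (fun k (f : bfun) => BFun (bdd_scale k (bf_bdd f)))
  (fun f : bfun => dual_norm f).

End DualSpace.
Arguments bfun {R} X.
Arguments dual_sp {R} X.

(** * The operator norm and completeness of the dual *)

Section DualNorm.
Context {R : realType} {X : nspace R} (hX : @is_banach_space R X setT).
Implicit Types (f g : X -> Cx R).

Lemma bdd0 f : is_bdd_functional f -> f (ns_zero X) = 0.
Proof. by move=> [_ [fZ _]]; rewrite -(ns_scale0 hX (ns_zero X)) fZ mul0r. Qed.

Lemma bddN f x : is_bdd_functional f -> f (ns_opp x) = - f x.
Proof. by move=> [_ [fZ _]]; rewrite -(ns_scaleN1 hX) fZ mulN1r. Qed.

Lemma dual_norm_le_ball f (M : R) :
  (forall x : X, ns_norm x <= 1 -> cmod (f x) <= M) -> dual_norm f <= M.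
Proof.
move=> fM; apply: ge_sup; last by move=> _ [x /= x1 <-]; exact: fM.
by exists (cmod (f (ns_zero X))), (ns_zero X) => //=; rewrite ns_norm0.
Qed.

Lemma dual_norm_le f (M : R) : 0 <= M ->
  (forall x : X, cmod (f x) <= M * ns_norm x) -> dual_norm f <= M.
Proof.
move=> M0 fM; apply: dual_norm_le_ball => x x1; apply: le_trans (fM x) _.
by rewrite ler_piMr.
Qed.

Lemma cmod_le_dual_norm_ball f (x : X) : is_bdd_functional f -> ns_norm x <= 1 ->
  cmod (f x) <= dual_norm f.
Proof.
move=> hf x1; apply: ub_le_sup; last by exists x.
have [M M0 fM] := bdd_bound hf (ns_norm_ge0 hX).
exists M => _ [y /= y1 <-]; apply: le_trans (fM y) _.
by rewrite ler_piMr.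
Qed.

Lemma dual_norm_ge0 f : is_bdd_functional f -> 0 <= dual_norm f.
Proof.
move=> hf; apply: le_trans (cmod_ge0 (f (ns_zero X))) _.
by apply: cmod_le_dual_norm_ball => //; rewrite ns_norm0.
Qed.

(** A nonzero [x] is rescaled to norm 1; a vector of norm 0 is the zero vector, where [f]
    vanishes. *)
Lemma cmod_le_dual_norm f (x : X) : is_bdd_functional f ->
  cmod (f x) <= dual_norm f * ns_norm x.
Proof.
move=> hf; have [x0|xN0] := eqVneq (ns_norm x) 0.
  by rewrite (ns_norm_eq0 hX x0) bdd0// cmod0 ns_norm0 ?mulr0.
have xgt0 : 0 < ns_norm x by rewrite lt_neqAle eq_sym xN0 (ns_norm_ge0 hX).
pose k : Cx R := complex.Complex (ns_norm x)^-1 0.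
have ck : cmod k = (ns_norm x)^-1 by rewrite cmod_real ger0_norm// invr_ge0 ltW.
have := @cmod_le_dual_norm_ball f (ns_scale k x) hf.
rewrite (ns_normZ hX) ck mulVf// => /(_ (lexx _)).
case: (hf) => _ [-> _]; rewrite cmodM ck => h.
by rewrite -ler_pdivrMr// mulrC.
Qed.

(** The limit is taken pointwise. The Cauchy estimate is uniform on bounded sets of [x], so letting
    one index tend to infinity gives boundedness of the limit and convergence in norm. *)
Lemma dual_complete (u : nat -> bfun X) :
  (forall e : R, 0 < e -> exists N, forall m n, (N <= m)%N -> (N <= n)%N ->
     ns_norm (@ns_sub R (dual_sp X) (u m) (u n)) < e) ->
  exists l : bfun X, forall e : R, 0 < e -> exists N, forall n, (N <= n)%N ->
     ns_norm (@ns_sub R (dual_sp X) (u n) l) < e.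
Proof.
move=> cu.
have ptw (e : R) : 0 < e -> exists N, forall m n, (N <= m)%N -> (N <= n)%N ->
    forall x, cmod (u m x - u n x) <= e * ns_norm x.
  move=> /cu[N hN]; exists N => m n Nm Nn x.
  apply: le_trans (cmod_le_dual_norm x (bf_bdd (@ns_sub R (dual_sp X) (u m) (u n)))) _.
  by apply: ler_wpM2r; [exact: ns_norm_ge0 | exact/ltW/hN].
have /choice[l hl] : forall x, exists l : Cx R, forall e : R, 0 < e ->
    exists N, forall n, (N <= n)%N -> cmod (u n x - l) < e.
  move=> x; apply: cx_cauchy_cvg => e e0.
  have x0 := ns_norm_ge0 hX x.
  have x1 : 0 < ns_norm x + 1 by lra.
  have [N hN] := ptw (e / (ns_norm x + 1)) (divr_gt0 e0 x1).
  exists N => m n Nm Nn; apply: le_lt_trans (hN _ _ Nm Nn x) _.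
  by rewrite mulrAC ltr_pdivrMr// ltr_pM2l//; lra.
have lD x y : l (ns_add x y) = l x + l y.
  apply: cmod_small_eq => e e0.
  have e30 : 0 < e / 3 by rewrite divr_gt0.
  have [N1 h1] := hl (ns_add x y) _ e30.
  have [N2 h2] := hl x _ e30; have [N3 h3] := hl y _ e30.
  pose n := maxn N1 (maxn N2 N3).
  have {}h1 := h1 n (leq_maxl _ _).
  have {}h2 := h2 n (leq_trans (leq_maxl _ _) (leq_maxr _ _)).
  have {}h3 := h3 n (leq_trans (leq_maxr _ _) (leq_maxr _ _)).
  have [uD _] := bf_bdd (u n); rewrite uD in h1.
  have -> : l (ns_add x y) - (l x + l y) =
     - ((u n x + u n y) - l (ns_add x y)) + ((u n x - l x) + (u n y - l y)) by ring.
  apply: le_trans (cmodD _ _) _; rewrite cmodN.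
  by have := cmodD (u n x - l x) (u n y - l y); lra.
have lZ k x : l (ns_scale k x) = k * l x.
  apply: cmod_small_eq => e e0.
  have k0 := cmod_ge0 k; have k1 : 0 < cmod k + 1 by lra.
  have e20 : 0 < e / 2 by rewrite divr_gt0.
  have [N1 h1] := hl (ns_scale k x) _ e20.
  have [N2 h2] := hl x _ (divr_gt0 e20 k1).
  have {}h1 := h1 (maxn N1 N2) (leq_maxl _ _).
  have {}h2 := h2 (maxn N1 N2) (leq_maxr _ _).
  set n := maxn N1 N2 in h1 h2.
  have [_ [uZ _]] := bf_bdd (u n); rewrite uZ in h1.
  have -> : l (ns_scale k x) - k * l x =
     - (k * u n x - l (ns_scale k x)) + k * (u n x - l x) by ring.
  apply: le_trans (cmodD _ _) _; rewrite cmodN cmodM.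
  have : cmod k * cmod (u n x - l x) <= e / 2.
    rewrite ltr_pdivlMr// in h2; apply: le_trans (ltW h2).
    by rewrite mulrC ler_wpM2l// ?cmod_ge0//; lra.
  by lra.
have lptw (e : R) : 0 < e -> exists N, forall n, (N <= n)%N ->
    forall x, cmod (u n x - l x) <= e * ns_norm x.
  move=> /ptw[N hN]; exists N => n Nn x; rewrite cmodB.
  by apply: (cmod_lim_le (N := N) (hl x)) => m Nm; exact: (hN m n Nm Nn x).
have lB : is_bdd_functional l.
  split=> //; split=> //.
  have [N /(_ N (leqnn _)) hN] := lptw 1 ltr01.
  have [M M0 uM] := bdd_bound (bf_bdd (u N)) (ns_norm_ge0 hX).
  exists (M + 1) => x; have -> : l x = u N x + - (u N x - l x) by ring.
  by apply: le_trans (cmodD _ _) _; rewrite cmodN mulrDl lerD.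
exists (BFun lB) => e e0.
have e20 : 0 < e / 2 by rewrite divr_gt0.
have [N hN] := lptw _ e20; exists N => n Nn.
apply: (@le_lt_trans _ _ (e / 2)); last by lra.
by apply: dual_norm_le => [|x]; [exact: ltW | exact: hN].
Qed.

Lemma dual_banach : @is_banach_space R (dual_sp X) setT.
Proof.
do 4 ![split=> //].
split; first by move=> f g h _ _ _; apply: bfun_ext => x /=; ring.
split; first by move=> f g _ _; apply: bfun_ext => x /=; ring.
split; first by move=> f _; apply: bfun_ext => x /=; ring.
split; first by move=> f _; apply: bfun_ext => x /=; ring.
split; first by move=> k l f _; apply: bfun_ext => x /=; ring.
split; first by move=> f _; apply: bfun_ext => x /=; ring.
split; first by move=> k f g _ _; apply: bfun_ext => x /=; ring.
split; first by move=> k l f _; apply: bfun_ext => x /=; ring.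
split; first by move=> f _; exact: (dual_norm_ge0 (bf_bdd f)).
split.
  move=> f _ f0; apply: bfun_ext => x /=; apply: cmod_eq0.
  apply/eqP; rewrite eq_le cmod_ge0 andbT.
  have := cmod_le_dual_norm x (bf_bdd f).
  by rewrite [dual_norm _]f0 mul0r.
split.
  (* For [k] nonzero the reverse inequality is this one applied to [k^-1] and [ns_scale k f]. *)
  have le k (f : dual_sp X) : ns_norm (ns_scale k f) <= cmod k * ns_norm f.
    apply: dual_norm_le => [|x].
      by rewrite mulr_ge0 ?cmod_ge0 ?(dual_norm_ge0 (bf_bdd f)).
    rewrite /= cmodM -mulrA ler_wpM2l ?cmod_ge0//.
    exact: cmod_le_dual_norm (bf_bdd f).
  move=> k f _; apply/eqP; rewrite eq_le le/=.
  have [k0|kN0] := pselect (k = 0).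
    rewrite k0 cmod0 mul0r.
    exact: (dual_norm_ge0 (bf_bdd (ns_scale (0 : Cx R) f : bfun X))).
  have ck : cmod k != 0 by apply/eqP => /cmod_eq0.
  have ckp : 0 < cmod k by rewrite lt_neqAle eq_sym ck cmod_ge0.
  rewrite -ler_pdivlMl//.
  have -> : (cmod k)^-1 = cmod k^-1.
    by apply: (mulfI ck); rewrite -cmodM !divff// ?cmod1//; apply/negP => /eqP.
  have {1}-> : f = ns_scale k^-1 (ns_scale k f).
    apply: bfun_ext => x /=; rewrite mulrA mulVf ?mul1r//.
    by apply/negP => /eqP.
  exact: le.
split.
  move=> f g _ _; apply: dual_norm_le => [|x].
    by rewrite addr_ge0 ?(dual_norm_ge0 (bf_bdd _)).
  apply: le_trans (cmodD _ _) _; rewrite mulrDl.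
  by rewrite lerD ?(cmod_le_dual_norm _ (bf_bdd _)).
by move=> u _ /dual_complete[l hl]; exists l.
Qed.

End DualNorm.

(** * Banach bimodules over a subset of an algebra *)

Section BanachBimodule.
Context {R : realType} {A : nalg R} {S : set A} {Y : bimod A}.
Context (hY : is_banach_bimodule S Y).
Implicit Types (a b : A) (y z : Y).

Lemma bm_space : @is_banach_space R Y setT.
Proof. by case: hY. Qed.

Lemma bm_lM a b y : S a -> S b -> bm_l (na_mul a b) y = bm_l a (bm_l b y).
Proof. by case: hY => _ [h _]; exact: h. Qed.

Lemma bm_rM a b y : S a -> S b -> bm_r y (na_mul a b) = bm_r (bm_r y a) b.
Proof. by case: hY => _ [_ [h _]]; exact: h. Qed.

Lemma bm_lr a b y : S a -> S b -> bm_r (bm_l a y) b = bm_l a (bm_r y b).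
Proof. by case: hY => _ [_ [_ [h _]]]; exact: h. Qed.

Lemma bm_lDl a b y : S a -> S b -> bm_l (ns_add a b) y = ns_add (bm_l a y) (bm_l b y).
Proof. by case: hY => _ [_ [_ [_ [h _]]]]; exact: h. Qed.

Lemma bm_rDr a b y : S a -> S b -> bm_r y (ns_add a b) = ns_add (bm_r y a) (bm_r y b).
Proof. by case: hY => _ [_ [_ [_ [_ [h _]]]]]; exact: h. Qed.

Lemma bm_lDr a y z : S a -> bm_l a (ns_add y z) = ns_add (bm_l a y) (bm_l a z).
Proof. by case: hY => _ [_ [_ [_ [_ [_ [h _]]]]]]; exact: h. Qed.

Lemma bm_rDl a y z : S a -> bm_r (ns_add y z) a = ns_add (bm_r y a) (bm_r z a).
Proof. by case: hY => _ [_ [_ [_ [_ [_ [_ [h _]]]]]]]; exact: h. Qed.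

Lemma bm_lZl k a y : S a -> bm_l (ns_scale k a) y = ns_scale k (bm_l a y).
Proof. by case: hY => _ [_ [_ [_ [_ [_ [_ [_ [h _]]]]]]]]; exact: h. Qed.

Lemma bm_rZr k a y : S a -> bm_r y (ns_scale k a) = ns_scale k (bm_r y a).
Proof. by case: hY => _ [_ [_ [_ [_ [_ [_ [_ [_ [h _]]]]]]]]]; exact: h. Qed.

Lemma bm_lZr k a y : S a -> bm_l a (ns_scale k y) = ns_scale k (bm_l a y).
Proof. by case: hY => _ [_ [_ [_ [_ [_ [_ [_ [_ [_ [h _]]]]]]]]]]; exact: h. Qed.

Lemma bm_rZl k a y : S a -> bm_r (ns_scale k y) a = ns_scale k (bm_r y a).
Proof. by case: hY => _ [_ [_ [_ [_ [_ [_ [_ [_ [_ [_ [h _]]]]]]]]]]]; exact: h. Qed.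

(** The constant in the definition may be negative; its absolute value serves as well, since the
    norms are nonnegative. *)
Lemma bm_bound (n0 : forall a, S a -> 0 <= ns_norm a) :
  exists2 M : R, 0 <= M & forall a y, S a ->
    ns_norm (bm_l a y) <= M * ns_norm a * ns_norm y /\
    ns_norm (bm_r y a) <= M * ns_norm a * ns_norm y.
Proof.
case: hY => _ [_ [_ [_ [_ [_ [_ [_ [_ [_ [_ [_ [M hM]]]]]]]]]]]].
exists `|M| => // a y Sa; have [h1 h2] := hM a y Sa.
suff h : M * ns_norm a * ns_norm y <= `|M| * ns_norm a * ns_norm y.
  by split; exact: le_trans h.
rewrite ler_wpM2r ?(ns_norm_ge0 bm_space)// ler_wpM2r ?n0//.
exact: ler_norm.
Qed.

Lemma bm_l0 a : S a -> bm_l a (ns_zero Y) = ns_zero Y.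
Proof.
by move=> Sa; apply: (ns_idem_eq0 bm_space); rewrite -bm_lDr// (ns_add0 bm_space).
Qed.

Lemma bm_r0 a : S a -> bm_r (ns_zero Y) a = ns_zero Y.
Proof.
by move=> Sa; apply: (ns_idem_eq0 bm_space); rewrite -bm_rDl// (ns_add0 bm_space).
Qed.

(** With its mirror image [bm_bdd_r], this ensures that [to_bfun] changes nothing in the dual
    actions of elements of [S]. *)
Lemma bm_bdd_l a : (forall b, S b -> 0 <= ns_norm b) -> S a ->
  forall f : Y -> Cx R, is_bdd_functional f -> is_bdd_functional (fun y => f (bm_l a y)).
Proof.
move=> n0 Sa f hf; have [M M0 hM] := bm_bound n0.
have [N N0 fN] := bdd_bound hf (ns_norm_ge0 bm_space).
have [fD [fZ _]] := hf.
split=> [x y|]; first by rewrite bm_lDr.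
split=> [k x|]; first by rewrite bm_lZr.
exists (N * (M * ns_norm a)) => x; apply: le_trans (fN _) _.
by rewrite -mulrA ler_wpM2l//; have [] := hM a x Sa.
Qed.

Lemma bm_bdd_r a : (forall b, S b -> 0 <= ns_norm b) -> S a ->
  forall f : Y -> Cx R, is_bdd_functional f -> is_bdd_functional (fun y => f (bm_r y a)).
Proof.
move=> n0 Sa f hf; have [M M0 hM] := bm_bound n0.
have [N N0 fN] := bdd_bound hf (ns_norm_ge0 bm_space).
have [fD [fZ _]] := hf.
split=> [x y|]; first by rewrite bm_rDl.
split=> [k x|]; first by rewrite bm_rZl.
exists (N * (M * ns_norm a)) => x; apply: le_trans (fN _) _.
by rewrite -mulrA ler_wpM2l//; have [] := hM a x Sa.
Qed.

End BanachBimodule.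

(** * The dual bimodule *)

Section DualBimodule.
Context {R : realType} {A : nalg R}.

Definition dual_bimod (X : bimod A) : bimod A := @BiMod R A (dual_sp X)
  (fun a (f : bfun X) => to_bfun (fun x => f (bm_r x a)))
  (fun (f : bfun X) a => to_bfun (fun x => f (bm_l a x))).

Context {S : set A} {X : bimod A} (hX : is_banach_bimodule S X).
Context (n0 : forall a, S a -> 0 <= ns_norm a).

Lemma dual_bm_lE a (f : dual_bimod X) x : S a ->
  (bm_l a f : bfun X) x = (f : bfun X) (bm_r x a).
Proof. by move=> Sa; rewrite /= to_bfunE//; exact: (bm_bdd_r hX n0 Sa (bf_bdd f)). Qed.

Lemma dual_bm_rE a (f : dual_bimod X) x : S a ->
  (bm_r f a : bfun X) x = (f : bfun X) (bm_l a x).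
Proof. by move=> Sa; rewrite /= to_bfunE//; exact: (bm_bdd_l hX n0 Sa (bf_bdd f)). Qed.

(** Links semi-innerness in the bundled dual module with the explicit formula in
    [approx_semi_inner_dual]. *)
Lemma dual_semi_innerE a (f xi eta : dual_bimod X) x : S a ->
  (ns_sub f (ns_sub (bm_l a xi) (bm_r eta a)) : bfun X) x =
  (f : bfun X) x - ((xi : bfun X) (bm_r x a) - (eta : bfun X) (bm_l a x)).
Proof. by move=> Sa; rewrite -(dual_bm_lE xi)// -(dual_bm_rE eta). Qed.

Lemma dual_bimod_banach : is_banach_bimodule S (dual_bimod X).
Proof.
have hX0 := bm_space hX.
have linD (f : bfun X) x y : f (ns_add x y) = f x + f y by case: (bf_bdd f).
have linZ (f : bfun X) k x : f (ns_scale k x) = k * f x by case: (bf_bdd f) => _ [].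
have bl (a : A) (f : bfun X) : S a -> is_bdd_functional (fun x => f (bm_l a x)).
  by move=> Sa; exact: (bm_bdd_l hX n0 Sa (bf_bdd f)).
have br (a : A) (f : bfun X) : S a -> is_bdd_functional (fun x => f (bm_r x a)).
  by move=> Sa; exact: (bm_bdd_r hX n0 Sa (bf_bdd f)).
split; first exact: dual_banach.
split.
  move=> a b f Sa Sb.
  (* The two sides must agree as functions, because [to_bfun] takes the whole function as
     argument. *)
  have E : (fun x => (f : bfun X) (bm_r x (na_mul a b))) =
           (fun x => (bm_l b f : bfun X) (bm_r x a)).
    by apply/funext => z; rewrite dual_bm_lE// (bm_rM hX).
  by apply: bfun_ext => x; rewrite {1}/bm_l/= E.
split.
  move=> a b f Sa Sb.
  have E : (fun x => (f : bfun X) (bm_l (na_mul a b) x)) =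
           (fun x => (bm_r f a : bfun X) (bm_l b x)).
    by apply/funext => z; rewrite dual_bm_rE// (bm_lM hX).
  by apply: bfun_ext => x; rewrite {1}/bm_r/= E.
split.
  move=> a b f Sa Sb; apply: bfun_ext => x.
  by rewrite dual_bm_rE// dual_bm_lE// dual_bm_lE// dual_bm_rE// (bm_lr hX).
split.
  move=> a b f Sa Sb.
  have E : (fun x => (f : bfun X) (bm_r x (ns_add a b))) =
      (fun x => (f : bfun X) (bm_r x a) + (f : bfun X) (bm_r x b)).
    by apply/funext => z; rewrite (bm_rDr hX)// linD.
  apply: bfun_ext => x; rewrite /= E !to_bfunE//; try exact: br.
  by apply: bdd_add; exact: br.
split.
  move=> a b f Sa Sb.
  have E : (fun x => (f : bfun X) (bm_l (ns_add a b) x)) =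
      (fun x => (f : bfun X) (bm_l a x) + (f : bfun X) (bm_l b x)).
    by apply/funext => z; rewrite (bm_lDl hX)// linD.
  apply: bfun_ext => x; rewrite /= E !to_bfunE//; try exact: bl.
  by apply: bdd_add; exact: bl.
split.
  by move=> a f g Sa; apply: bfun_ext => x; rewrite dual_bm_lE//= !to_bfunE//; exact: br.
split.
  by move=> a f g Sa; apply: bfun_ext => x; rewrite dual_bm_rE//= !to_bfunE//; exact: bl.
split.
  move=> k a f Sa.
  have E : (fun x => (f : bfun X) (bm_r x (ns_scale k a))) =
      (fun x => k * (f : bfun X) (bm_r x a)).
    by apply/funext => z; rewrite (bm_rZr hX)// linZ.
  apply: bfun_ext => x; rewrite /= E !to_bfunE//; first exact: br.
  by apply: bdd_scale; exact: br.
split.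
  move=> k a f Sa.
  have E : (fun x => (f : bfun X) (bm_l (ns_scale k a) x)) =
      (fun x => k * (f : bfun X) (bm_l a x)).
    by apply/funext => z; rewrite (bm_lZl hX)// linZ.
  apply: bfun_ext => x; rewrite /= E !to_bfunE//; first exact: bl.
  by apply: bdd_scale; exact: bl.
split.
  by move=> k a f Sa; apply: bfun_ext => x; rewrite dual_bm_lE//= !to_bfunE//; exact: br.
split.
  by move=> k a f Sa; apply: bfun_ext => x; rewrite dual_bm_rE//= !to_bfunE//; exact: bl.
have [M M0 hM] := bm_bound hX n0; exists M => a f Sa.
have f0 := dual_norm_ge0 hX0 (bf_bdd f).
have c0 : 0 <= M * ns_norm a * dual_norm (f : bfun X) by rewrite !mulr_ge0 ?n0.
have fl := cmod_le_dual_norm hX0 _ (bf_bdd f).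
have step x z : ns_norm z <= M * ns_norm a * ns_norm x ->
    cmod ((f : bfun X) z) <= M * ns_norm a * dual_norm (f : bfun X) * ns_norm x.
  move=> zx; apply: le_trans (fl _) _.
  by rewrite [leRHS](_ : _ = dual_norm (f : bfun X) * (M * ns_norm a * ns_norm x));
    [rewrite ler_wpM2l | ring].
split; apply: (dual_norm_le hX0) => // x; rewrite to_bfunE; try exact: br; try exact: bl;
  by apply: step; have [] := hM a x Sa.
Qed.

End DualBimodule.

(** * Bimodules with one trivial action *)

Section OneSidedBimodules.
Context {R : realType} {A : nalg R}.

(** With one action zero, the Leibniz rule keeps a single term, and the identity map of an algebra
    becomes a derivation into the algebra itself. *)
Definition lzero_bimod (Y : bimod A) : bimod A :=
  @BiMod R A Y (fun _ _ => ns_zero Y) (@bm_r R A Y).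

Definition rzero_bimod (Y : bimod A) : bimod A :=
  @BiMod R A Y (@bm_l R A Y) (fun _ _ => ns_zero Y).

Definition self_bimod : bimod A := @BiMod R A A (@na_mul R A) (@na_mul R A).

Lemma ns_scale_zero (V : nspace R) (hV : @is_banach_space R V setT) k :
  ns_scale k (ns_zero V) = ns_zero V.
Proof. by rewrite -{1}(ns_scale0 hV (ns_zero V)) (ns_scaleA hV) mulr0 (ns_scale0 hV). Qed.

Context {S : set A} (n0 : forall a, S a -> 0 <= ns_norm a).

Lemma lzero_bimod_banach (Y : bimod A) :
  is_banach_bimodule S Y -> is_banach_bimodule S (lzero_bimod Y).
Proof.
move=> hY; have h0 := bm_space hY.
have [M M0 hM] := bm_bound hY n0.
case: (hY) => _ [_ [h2 [_ [_ [h5 [_ [h7 [_ [h9 [_ [h11 _]]]]]]]]]]].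
rewrite /is_banach_bimodule.
repeat (match goal with |- _ /\ _ => split end) => //=;
  try by move=> *; rewrite ?(ns_add0 h0) ?(ns_scale_zero h0).
  by move=> a b y Sa Sb; exact: (bm_r0 hY).
exists M => a y Sa; split; last by have [] := hM a y Sa.
by rewrite ns_norm0 ?mulr_ge0 ?n0 ?(ns_norm_ge0 h0).
Qed.

Lemma rzero_bimod_banach (Y : bimod A) :
  is_banach_bimodule S Y -> is_banach_bimodule S (rzero_bimod Y).
Proof.
move=> hY; have h0 := bm_space hY.
have [M M0 hM] := bm_bound hY n0.
case: (hY) => _ [h1 [_ [_ [h4 [_ [h6 [_ [h8 [_ [h10 _]]]]]]]]]].
rewrite /is_banach_bimodule.
repeat (match goal with |- _ /\ _ => split end) => //=;
  try by move=> *; rewrite ?(ns_add0 h0) ?(ns_scale_zero h0).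
  by move=> a b y Sa Sb; rewrite (bm_l0 hY).
exists M => a y Sa; split; first by have [] := hM a y Sa.
by rewrite ns_norm0 ?mulr_ge0 ?n0 ?(ns_norm_ge0 h0).
Qed.

Lemma self_bimod_banach :
  is_banach_algebra A setT -> is_banach_bimodule setT self_bimod.
Proof.
move=> [h0 [_ [hA [hDr [hDl [hZl [hZr hM]]]]]]].
rewrite /is_banach_bimodule.
repeat (match goal with |- _ /\ _ => split end) => //=;
  try by move=> *; rewrite -?hA ?hDr ?hDl ?hZl ?hZr.
exists 1 => a y _; rewrite !mul1r; split; first exact: hM.
by rewrite mulrC; exact: hM.
Qed.

End OneSidedBimodules.
Arguments self_bimod {R} A.

(** * Nets and finite sets of elements *)

Section Nets.
Context {R : realType}.

(** Directedness supplies one index that is good for the whole list. *)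
Lemma net_list (I : Type) (le : I -> I -> Prop) (T : Type) (u : T -> I -> R) :
  directed le -> (forall a, net_to0 le (u a)) ->
  forall (s : list T) (e : R), 0 < e -> exists i, forall a, List.In a s -> u a i < e.
Proof.
move=> [[i1 _] [_ [letr ledir]]] hu s e e0.
suff [i hi] : exists i, forall j, le i j -> forall a, List.In a s -> u a j < e.
  have [j [ij _]] := ledir i i; by exists j => a /hi; exact.
elim: s => [|a s [i hi]]; first by exists i1.
have [i' hi'] := hu a e e0; have [j [ij i'j]] := ledir i i'.
exists j => k jk b /= [<-|bs].
  by apply: le_lt_trans (ler_norm _) _; apply: hi'; exact: letr jk.
by apply: (hi k) bs; exact: letr jk.
Qed.

(** The net is indexed by pairs of a finite list and a tolerance, which grow as the list gains
    elements and the tolerance decreases. *)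
Lemma approx_semi_inner_list (A : nalg R) (S : set A) (Y : bimod A) (D : A -> Y) :
  @is_banach_space R Y setT ->
  (forall (s : list A) (e : R), 0 < e -> exists xi eta : Y,
     forall a, List.In a s -> S a ->
     ns_norm (ns_sub (D a) (ns_sub (bm_l a xi) (bm_r eta a))) < e) ->
  approx_semi_inner S D.
Proof.
move=> hY h.
have /choice[z hz] : forall i : list A * {posnum R}, exists z : Y * Y,
    forall a, List.In a i.1 -> S a ->
    ns_norm (ns_sub (D a) (ns_sub (bm_l a z.1) (bm_r z.2 a))) < i.2%:num.
  by move=> [s e]; have [|x [y xy]] := h s e%:num => //; exists (x, y).
exists (list A * {posnum R})%type.
exists (fun i j => (forall a, List.In a i.1 -> List.In a j.1) /\ j.2%:num <= i.2%:num).
exists (fun i => (z i).1), (fun i => (z i).2); split.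
  split; first by exists (nil, 1%:pos).
  split; first by move=> i; split.
  split; first by move=> i j k [ij ji] [jk kj]; split=> [a /ij/jk//|]; exact: le_trans ji.
  move=> [s d] [t e].
  exists ((s ++ t)%list, (Order.min d%:num e%:num)%:pos) => /=.
  by split; split=> [a ?|]; rewrite ?ge_min ?lexx ?orbT//; apply/List.in_app_iff; auto.
move=> a Sa e e0; exists ((a :: nil)%list, PosNum e0) => i [ai ie].
rewrite ger0_norm ?(ns_norm_ge0 hY)//; apply: lt_le_trans ie.
by apply: hz => //; apply: ai; left.
Qed.

End Nets.

(** * One-sided approximate units *)

Section ApproximateIdentities.
Context {R : realType} {A : nalg R} (hA : is_banach_algebra A setT).

Let hA0 : @is_banach_space R A setT. Proof. by case: hA. Qed.
Let n0 (a : A) : setT a -> 0 <= ns_norm a.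
Proof. by move=> _; exact: ns_norm_ge0. Qed.

(** With zero right action, semi-innerness of the identity map says that [a] is close to [a . xi],
    so [xi] is the unit. *)
Lemma approx_semi_contractible_right_unit : approx_semi_contractible A setT ->
  forall (s : list A) (e : R), 0 < e ->
  exists u : A, forall a, List.In a s -> ns_norm (ns_sub a (na_mul a u)) < e.
Proof.
move=> hc s e e0.
have hY := rzero_bimod_banach n0 (self_bimod_banach hA).
have [|I [le [xi [eta [dle h]]]]] := hc _ hY id.
  split=> //; split=> //; split=> [a b _ _ /=|a _ d d0].
    by rewrite (ns_addr0 hA0).
  by exists d.
have [i hi] := net_list dle (fun a => h a Logic.I) s e0.
by exists (xi i) => a /hi /=; rewrite /ns_sub (ns_opp0 hA0) (ns_addr0 hA0).
Qed.

(** With zero left action only [- eta . a] survives, so the unit is the opposite of [eta]. *)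
Lemma approx_semi_contractible_left_unit : approx_semi_contractible A setT ->
  forall (s : list A) (e : R), 0 < e ->
  exists u : A, forall a, List.In a s -> ns_norm (ns_sub a (na_mul u a)) < e.
Proof.
move=> hc s e e0.
have hY := lzero_bimod_banach n0 (self_bimod_banach hA).
have [|I [le [xi [eta [dle h]]]]] := hc _ hY id.
  split=> //; split=> //; split=> [a b _ _ /=|a _ d d0].
    by rewrite (ns_add0 hA0).
  by exists d.
have [i hi] := net_list dle (fun a => h a Logic.I) s e0.
exists (ns_opp (eta i)) => a /hi /=.
have -> // : na_mul (ns_opp (eta i)) a = ns_sub (ns_zero A) (na_mul (eta i) a).
rewrite /ns_sub (ns_add0 hA0) -!(ns_scaleN1 hA0).
by case: hA => _ [_ [_ [_ [_ [h1 _]]]]]; rewrite h1.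
Qed.

(** Evaluation at [a] is the image of [a] in the bidual; this canonical embedding is the derivation
    used for the units below. *)
Lemma eval_bdd (a : A) : is_bdd_functional (fun f : dual_sp A => (f : bfun A) a).
Proof.
split=> //; split=> //; exists (ns_norm a) => f.
by rewrite mulrC; exact: (cmod_le_dual_norm hA0 a (bf_bdd f)).
Qed.

Lemma eval_cont (a : A) (e : R) : 0 < e ->
  exists2 d : R, 0 < d & forall b, setT b -> ns_norm (ns_sub b a) < d ->
    dual_norm (fun f : dual_sp A => (f : bfun A) b - (f : bfun A) a) < e.
Proof.
move=> e0; exists e => // b _; apply: le_lt_trans.
apply: (dual_norm_le (dual_banach hA0)) => [|f]; first exact: (ns_norm_ge0 hA0).
rewrite -(bddN hA0 a (bf_bdd f)); have [<- _] := bf_bdd f.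
by rewrite mulrC; exact: (cmod_le_dual_norm hA0 _ (bf_bdd f)).
Qed.

(* Instead of an approximate identity in [A], semi-amenability yields one in the
   bidual, and that suffices: it acts on dual modules through [a |-> f (x . a)]. *)
Lemma approx_semi_amenable_right_unit : approx_semi_amenable A setT ->
  forall (s : list A) (e : R), 0 < e ->
  exists E : bfun (dual_sp A), forall a, List.In a s -> forall f : bfun A,
    cmod (f a - E (to_bfun (fun b => f (na_mul a b)))) <= e * dual_norm f.
Proof.
move=> hc s e e0.
have hD := dual_bimod_banach (self_bimod_banach hA) n0.
have hY := lzero_bimod_banach n0 hD.
have [|I [le [xi [eta [dle [bxi [beta h]]]]]]] := hc _ hY (fun a (f : bfun A) => f a).
  split; first by move=> a _; exact: eval_bdd.
  split; first by move=> a b f _ _; case: (bf_bdd f).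
  split; first by move=> k a f _; case: (bf_bdd f) => _ [].
  split; last by move=> a _ d d0; exact: eval_cont.
  by move=> a b f _ _; rewrite (dual_bm_rE (self_bimod_banach hA) n0)//= addr0.
have [i hi] := net_list dle (fun a => h a Logic.I) s e0.
exists (BFun (bxi i)) => a /hi /= ha f.
(* The trivial action leaves the constant [eta i] of zero, which is itself zero and so a bounded
   functional. *)
have bl : is_bdd_functional (fun g : dual_sp A => eta i (ns_zero (dual_sp A))).
  exact: (bm_bdd_l hY n0 (a := a) Logic.I (beta i)).
have br := bm_bdd_r hY n0 (a := a) Logic.I (bxi i).
have G := bdd_add (eval_bdd a) (bdd_opp (bdd_add br (bdd_opp bl))).
have Gf := cmod_le_dual_norm (dual_banach hA0) f G.
apply: (@le_trans _ _ _ _ _ _ (le_trans Gf _)).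
  by rewrite (bdd0 (dual_banach hA0) (beta i)) subr0.
by rewrite ler_wpM2r ?(dual_norm_ge0 hA0 (bf_bdd f))// ltW.
Qed.

(** Here the right action on the dual of [A] is zero, so the [xi] term vanishes and the unit is the
    opposite of [eta]. *)
Lemma approx_semi_amenable_left_unit : approx_semi_amenable A setT ->
  forall (s : list A) (e : R), 0 < e ->
  exists E : bfun (dual_sp A), forall a, List.In a s -> forall f : bfun A,
    cmod (f a - E (to_bfun (fun b => f (na_mul b a)))) <= e * dual_norm f.
Proof.
move=> hc s e e0.
have hD := dual_bimod_banach (self_bimod_banach hA) n0.
have hY := rzero_bimod_banach n0 hD.
have [|I [le [xi [eta [dle [bxi [beta h]]]]]]] := hc _ hY (fun a (f : bfun A) => f a).
  split; first by move=> a _; exact: eval_bdd.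
  split; first by move=> a b f _ _; case: (bf_bdd f).
  split; first by move=> k a f _; case: (bf_bdd f) => _ [].
  split; last by move=> a _ d d0; exact: eval_cont.
  by move=> a b f _ _; rewrite (dual_bm_lE (self_bimod_banach hA) n0)//= add0r.
have [i hi] := net_list dle (fun a => h a Logic.I) s e0.
exists (BFun (bdd_opp (beta i))) => a /hi /= ha f.
have bl := bm_bdd_l hY n0 (a := a) Logic.I (beta i).
have br : is_bdd_functional (fun g : dual_sp A => xi i (ns_zero (dual_sp A))).
  exact: (bm_bdd_r hY n0 (a := a) Logic.I (bxi i)).
have G := bdd_add (eval_bdd a) (bdd_opp (bdd_add br (bdd_opp bl))).
have Gf := cmod_le_dual_norm (dual_banach hA0) f G.
apply: (@le_trans _ _ _ _ _ _ (le_trans Gf _)).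
  by rewrite (bdd0 (dual_banach hA0) (bxi i)) sub0r.
by rewrite ler_wpM2r ?(dual_norm_ge0 hA0 (bf_bdd f))// ltW.
Qed.

End ApproximateIdentities.

(** * Coordinate embeddings and finite restrictions in a family algebra *)

Section Families.
Context {R : realType} {L : choiceType} {A : L -> nalg R}.

Definition coord_inj (l : L) (x : A l) : forall m, A m :=
  @dfwith L A (fun m => ns_zero (A m)) l x.

Definition fam_restrict (F : seq L) (a : forall m, A m) : forall m, A m :=
  fun m => if m \in F then a m else ns_zero (A m).

(* The only features of [l^p] and [c_0] that matter: coordinate embeddings are
   isometric and every element is the limit of its finite restrictions. *)
Definition is_restriction_dense (nrm : (forall m, A m) -> R)
    (S : set (@fam_alg R L A nrm)) : Prop :=
  [/\ forall a, S a -> 0 <= nrm a,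
      forall l (x : A l), S (coord_inj x) /\ nrm (coord_inj x) = ns_norm x,
      forall F a, S a -> S (fam_restrict F a) &
      forall a, S a -> forall d : R, 0 < d -> exists F : seq L,
        forall G : seq L, {subset F <= G} ->
        nrm (@ns_sub R (@fam_alg R L A nrm) (fam_restrict G a) a) < d].

Context (hA : forall l, is_banach_algebra (A l) setT).

Let hA0 l : @is_banach_space R (A l) setT. Proof. by case: (hA l). Qed.

Lemma na_mul0 l (x : A l) : na_mul x (ns_zero (A l)) = ns_zero (A l).
Proof. exact: (bm_l0 (self_bimod_banach (hA l))). Qed.

Lemma na_0mul l (x : A l) : na_mul (ns_zero (A l)) x = ns_zero (A l).
Proof. exact: (bm_r0 (self_bimod_banach (hA l))). Qed.

Lemma coord_inj_eq l (x : A l) (a : forall m, A m) :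
  a l = x -> (forall m, l != m -> a m = ns_zero (A m)) -> coord_inj x = a.
Proof.
move=> al am; apply: functional_extensionality_dep => m; rewrite /coord_inj.
by have [<-|lm] := eqVneq l m; [rewrite dfwithin | rewrite dfwithout// am].
Qed.

Lemma coord_inj_in l (x : A l) : coord_inj x l = x.
Proof. exact: dfwithin. Qed.

Lemma coord_inj_out l (x : A l) m : l != m -> coord_inj x m = ns_zero (A m).
Proof. exact: dfwithout. Qed.

Context {nrm : (forall m, A m) -> R}.
Notation B := (@fam_alg R L A nrm).
Implicit Types (a b : B).

Lemma coord_injD l (x y : A l) :
  coord_inj (ns_add x y) = ns_add (coord_inj x : B) (coord_inj y : B).
Proof.
apply: coord_inj_eq => [|m lm] /=; first by rewrite !coord_inj_in.
by rewrite !coord_inj_out// (ns_add0 (hA0 m)).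
Qed.

Lemma coord_injZ l k (x : A l) : coord_inj (ns_scale k x) = ns_scale k (coord_inj x : B).
Proof.
apply: coord_inj_eq => [|m lm] /=; first by rewrite !coord_inj_in.
by rewrite !coord_inj_out// (ns_scale_zero (hA0 m)).
Qed.

Lemma coord_injB l (x y : A l) :
  coord_inj (ns_sub x y) = ns_sub (coord_inj x : B) (coord_inj y : B).
Proof.
apply: coord_inj_eq => [|m lm]; rewrite /ns_sub/=; first by rewrite !coord_inj_in.
by rewrite !coord_inj_out// (ns_addN (hA0 m)).
Qed.

(** With [coord_inj_mul], this makes [A l] an ideal on which any element acts through its coordinate
    [l] alone, the fact behind localisation. *)
Lemma mul_coord_inj a l (x : A l) :
  na_mul a (coord_inj x : B) = coord_inj (na_mul (a l) x).
Proof.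
apply/esym/coord_inj_eq => [|m lm] /=; first by rewrite coord_inj_in.
by rewrite coord_inj_out// na_mul0.
Qed.

Lemma coord_inj_mul a l (x : A l) :
  na_mul (coord_inj x : B) a = coord_inj (na_mul x (a l)).
Proof.
apply/esym/coord_inj_eq => [|m lm] /=; first by rewrite coord_inj_in.
by rewrite coord_inj_out// na_0mul.
Qed.

Lemma coord_injM l (x y : A l) :
  coord_inj (na_mul x y) = na_mul (coord_inj x : B) (coord_inj y : B).
Proof. by rewrite mul_coord_inj coord_inj_in. Qed.

Lemma restrict_cons l F a : l \notin F ->
  fam_restrict (l :: F) a = ns_add (coord_inj (a l) : B) (fam_restrict F a : B).
Proof.
move=> lF; apply: functional_extensionality_dep => m /=.
rewrite /fam_restrict inE; have [->|ml] := eqVneq m l.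
  by rewrite coord_inj_in (negbTE lF) (ns_addr0 (hA0 l)).
by rewrite coord_inj_out 1?eq_sym// (ns_add0 (hA0 m)).
Qed.

(** Covers index lists with repetitions in the induction on [F]. *)
Lemma restrict_cons_in l F (a : forall m, A m) : l \in F ->
  fam_restrict (l :: F) a = fam_restrict F a.
Proof.
move=> lF; apply: functional_extensionality_dep => m.
by rewrite /fam_restrict inE; have [->|//] := eqVneq m l; rewrite lF.
Qed.

Definition res_bimod l (Y : bimod B) : bimod (A l) := @BiMod R (A l) Y
  (fun x y => bm_l (coord_inj x : B) y) (fun y x => bm_r y (coord_inj x : B)).

Context {S : set B} (hS : is_restriction_dense S).

(** The embedding of [A l] is linear, multiplicative and isometric with values in [S], so the axioms
    and the constant [M] are inherited. *)
Lemma res_bimod_banach l (Y : bimod B) :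
  is_banach_bimodule S Y -> is_banach_bimodule setT (res_bimod l Y).
Proof.
move=> hY; have [n0 Si _ _] := hS; have Sl (x : A l) := (Si l x).1.
have [M M0 hM] := bm_bound hY n0.
split; first exact: (bm_space hY).
split; first by move=> a b y _ _; rewrite /= coord_injM (bm_lM hY).
split; first by move=> a b y _ _; rewrite /= coord_injM (bm_rM hY).
split; first by move=> a b y _ _; rewrite /= (bm_lr hY).
split; first by move=> a b y _ _; rewrite /= coord_injD (bm_lDl hY).
split; first by move=> a b y _ _; rewrite /= coord_injD (bm_rDr hY).
split; first by move=> a y z _; rewrite /= (bm_lDr hY).
split; first by move=> a y z _; rewrite /= (bm_rDl hY).
split; first by move=> k a y _; rewrite /= coord_injZ (bm_lZl hY).
split; first by move=> k a y _; rewrite /= coord_injZ (bm_rZr hY).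
split; first by move=> k a y _; rewrite /= (bm_lZr hY).
split; first by move=> k a y _; rewrite /= (bm_rZl hY).
by exists M => a y _; rewrite -(Si l a).2; exact: hM.
Qed.

(** * Gluing coordinatewise implementations of a derivation *)

Section Derivation.
Context {Y : bimod B} (hY : is_banach_bimodule S Y) {D : B -> Y}.
Context (hD : is_cont_derivation S D).
Let hY0 := bm_space hY.

(** Restrictions of [a] converge to [a], and [D] is continuous there. *)
Lemma restrict_list (s : list B) (e : R) : 0 < e -> exists F : seq L,
  forall a, List.In a s -> S a -> ns_norm (ns_sub (D (fam_restrict F a)) (D a)) < e.
Proof.
move=> e0; have [_ _ SF Sd] := hS; have [_ [_ [_ Dc]]] := hD.
(* Asking for all larger [G] lets the index lists of successive elements be concatenated. *)
suff [F hF] : exists F : seq L, forall G, {subset F <= G} -> forall a, List.In a s ->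
    S a -> ns_norm (ns_sub (D (fam_restrict G a)) (D a)) < e.
  by exists F; exact: hF.
elim: s => [|a s [F hF]]; first by exists [::].
have [Sa|nSa] := pselect (S a); last first.
  by exists F => G FG b [<-//|]; exact: hF.
have [d d0 hd] := Dc a Sa e e0; have [F' hF'] := Sd a Sa d d0.
exists (F ++ F') => G FG b [<- _|bs Sb].
  apply: hd; first exact: SF.
  by apply: hF' => m mF; apply: FG; rewrite mem_cat mF orbT.
by apply: hF => // m mF; apply: FG; rewrite mem_cat mF.
Qed.

(* [xi'] is annihilated by every coordinate other than [l], so the corrections
   chosen for different coordinates do not interact when they are summed. *)
Theorem family_approx_semi_inner :
  (forall l (s : list (A l)) (e : R), 0 < e -> exists xi eta : Y,
     forall x, List.In x s -> ns_norm (ns_sub (D (coord_inj x))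
       (ns_sub (bm_l (coord_inj x : B) xi) (bm_r eta (coord_inj x : B)))) < e) ->
  (forall l (s : list (A l)) (xi : Y) (e : R), 0 < e -> exists2 xi' : Y,
     forall b, S b -> bm_l b xi' = bm_l (coord_inj (b l) : B) xi' &
     forall x, List.In x s ->
       ns_norm (ns_sub (bm_l (coord_inj x : B) xi) (bm_l (coord_inj x : B) xi')) < e) ->
  (forall l (s : list (A l)) (eta : Y) (e : R), 0 < e -> exists2 eta' : Y,
     forall b, S b -> bm_r eta' b = bm_r eta' (coord_inj (b l) : B) &
     forall x, List.In x s ->
       ns_norm (ns_sub (bm_r eta (coord_inj x : B)) (bm_r eta' (coord_inj x : B))) < e) ->
  approx_semi_inner S D.
Proof.
move=> loc locl locr; have [_ Si SF _] := hS; have [Dadd _] := hD.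
apply: (approx_semi_inner_list hY0) => s e e0.
(* Only the argument of [D] is restricted; [xi] and [eta] are still acted on by the full [a]. *)
suff fin (F : seq L) (d : R) : 0 < d -> exists xi eta : Y, forall a, List.In a s ->
    S a -> ns_norm (ns_sub (D (fam_restrict F a)) (ns_sub (bm_l a xi) (bm_r eta a))) < d.
  have e20 : 0 < e / 2 by rewrite divr_gt0.
  have [F hF] := restrict_list s e20; have [xi [eta h]] := fin F _ e20.
  exists xi, eta => a sa Sa; apply: le_lt_trans (ns_dist_tri hY0 (D (fam_restrict F a)) _ _) _.
  rewrite (ns_distC hY0 (D a)).
  by have := hF a sa Sa; have := h a sa Sa; lra.
elim: F d => [|l F IH] d d0.
  exists (ns_zero Y), (ns_zero Y) => a _ Sa.
  rewrite (bm_l0 hY)// (bm_r0 hY)// !(ns_sub0 hY0).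
  suff -> : D (fam_restrict [::] a) = ns_zero Y by rewrite (ns_norm0 hY0).
  apply: (ns_idem_eq0 hY0); rewrite -Dadd; try exact: SF.
  congr D; apply: functional_extensionality_dep => m /=.
  by rewrite /fam_restrict (ns_add0 (hA0 m)).
have [lF|lF] := boolP (l \in F).
  have [xi [eta h]] := IH _ d0; exists xi, eta => a sa Sa.
  by rewrite restrict_cons_in//; exact: h.
(* Four errors add up to [d]: the induction hypothesis, the implementation at [l], and the
   localisations of [x] and of [y]. *)
have d40 : 0 < d / 4 by rewrite divr_gt0.
have [xi [eta h]] := IH _ d40.
pose t := List.map (fun a : B => a l) s.
have [x [y hxy]] := loc l t _ d40.
have [x' x'l hx'] := locl l t x _ d40.
have [y' y'l hy'] := locr l t y _ d40.
exists (ns_add x' xi), (ns_add y' eta) => a sa Sa.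
have ta : List.In (a l) t by exact: (List.in_map (fun a : B => a l)).
rewrite restrict_cons// Dadd; [|exact: (Si l (a l)).1|exact: SF].
rewrite (bm_lDr hY)// (bm_rDl hY)// (ns_subDD hY0).
apply: le_lt_trans (ns_distD hY0 _ _ _ _) _.
have := h a sa Sa; have := hxy _ ta; have := hx' _ ta; have := hy' _ ta.
(* By localisation the full [a] acts on [x'] and [y'] through [a l] only, which reduces the new
   terms to the algebra [A l]. *)
rewrite (x'l a Sa) (y'l a Sa).
set ia := (coord_inj (a l) : B).
have := ns_dist_tri hY0 (ns_sub (bm_l ia x) (bm_r y ia)) (D ia)
  (ns_sub (bm_l ia x') (bm_r y' ia)).
have := ns_distB hY0 (bm_l ia x) (bm_r y ia) (bm_l ia x') (bm_r y' ia).
by lra.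
Qed.

End Derivation.
End Families.

(** * Passage from the coordinate algebras to the family algebra *)

Lemma small_factor {R : realType} (c e : R) : 0 <= c -> 0 < e ->
  exists2 d : R, 0 < d & c * d < e.
Proof.
(* Dividing by [c + 1] also covers [c = 0]. *)
move=> c0 e0; exists (e / (c + 1)); first by rewrite divr_gt0//; lra.
by rewrite mulrA ltr_pdivrMr ?(mulrC c) ?ltr_pM2l//; lra.
Qed.

Lemma bm_lBl {R : realType} (A : nalg R) (Y : bimod A) (a b : A) (y : Y) :
  @is_banach_space R A setT -> is_banach_bimodule setT Y ->
  ns_sub (bm_l a y) (bm_l b y) = bm_l (ns_sub a b) y.
Proof.
move=> hA hY; rewrite /ns_sub (bm_lDl hY)// -(ns_scaleN1 hA) (bm_lZl hY)//.
by rewrite (ns_scaleN1 (bm_space hY)).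
Qed.

Lemma bm_rBr {R : realType} (A : nalg R) (Y : bimod A) (a b : A) (y : Y) :
  @is_banach_space R A setT -> is_banach_bimodule setT Y ->
  ns_sub (bm_r y a) (bm_r y b) = bm_r y (ns_sub a b).
Proof.
move=> hA hY; rewrite /ns_sub (bm_rDr hY)// -(ns_scaleN1 hA) (bm_rZr hY)//.
by rewrite (ns_scaleN1 (bm_space hY)).
Qed.

Section FamilyPermanence.
Context {R : realType} {L : choiceType} {A : L -> nalg R}.
Context (hA : forall l, is_banach_algebra (A l) setT).
Context {nrm : (forall m, A m) -> R}.
Notation B := (@fam_alg R L A nrm).
Context {S : set B} (hS : is_restriction_dense S).

Let hA0 l : @is_banach_space R (A l) setT. Proof. by case: (hA l). Qed.

Theorem family_approx_semi_contractible :
  (forall l, approx_semi_contractible (A l) setT) -> approx_semi_contractible B S.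
Proof.
move=> hc Y hY D hD; have hY0 := bm_space hY; have [n0 Si _ _] := hS.
have [DD [DZ [DM Dc]]] := hD; have [M M0 hM] := bm_bound hY n0.
have Sl l (x : A l) := (Si l x).1.
apply: (family_approx_semi_inner hA hS hY hD).
(* Semi-contractibility of [A l] is applied to [D] pulled back along the embedding. *)
- move=> l s e e0; pose Dl (x : A l) : res_bimod l Y := D (coord_inj x).
  have [|I [le [xi [eta [dle h]]]]] := hc l _ (res_bimod_banach hA hS l hY) Dl.
    split; first by move=> a b _ _; rewrite /Dl (coord_injD hA (nrm := nrm)) DD.
    split; first by move=> k a _; rewrite /Dl (coord_injZ hA (nrm := nrm)) DZ.
    split; first by move=> a b _ _; rewrite /Dl (coord_injM hA (nrm := nrm)) DM.
    move=> a _ d d0; have [c c0 hc'] := Dc _ (Sl l a) d d0.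
    exists c => // b _ ba; apply: hc'; first exact: Sl.
    by rewrite -(coord_injB hA) /= (Si _ _).2.
  have [i hi] := net_list dle (fun a => h a Logic.I) s e0.
  by exists (xi i), (eta i).
- move=> l s xi e e0.
  have [d d0 cd] := small_factor (mulr_ge0 M0 (ns_norm_ge0 hY0 xi)) e0.
  have [u hu] := approx_semi_contractible_right_unit (hA l) (hc l) s d0.
  (* Since [b . (u . xi) = (b u) . xi] and [b u] lies in [A l], only [b l] matters; [u] being a
     right unit up to [d] bounds the change. *)
  exists (bm_l (coord_inj u : B) xi) => [b Sb|x /hu xu].
    by rewrite -!(bm_lM hY)// !(mul_coord_inj hA) coord_inj_in.
  rewrite -(bm_lM hY)// -(coord_injM hA (nrm := nrm)).
  have := bm_lBl x (na_mul x u) (xi : res_bimod l Y) (hA0 l) (res_bimod_banach hA hS l hY).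
  rewrite /= => ->; apply: le_lt_trans cd.
  have [/le_trans + _] := hM (coord_inj (ns_sub x (na_mul x u))) xi (Sl _ _); apply.
  rewrite [X in _ * X * _](Si _ _).2 mulrAC ler_wpM2l ?(ltW xu)//.
  by rewrite mulr_ge0 ?(ns_norm_ge0 hY0).
- move=> l s eta e e0.
  have [d d0 cd] := small_factor (mulr_ge0 M0 (ns_norm_ge0 hY0 eta)) e0.
  have [u hu] := approx_semi_contractible_left_unit (hA l) (hc l) s d0.
  exists (bm_r eta (coord_inj u : B)) => [b Sb|x /hu xu].
    by rewrite -!(bm_rM hY)// !(coord_inj_mul hA) coord_inj_in.
  rewrite -(bm_rM hY)// -(coord_injM hA (nrm := nrm)).
  have := bm_rBr x (na_mul u x) (eta : res_bimod l Y) (hA0 l) (res_bimod_banach hA hS l hY).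
  rewrite /= => ->; apply: le_lt_trans cd.
  have [_ /le_trans +] := hM (coord_inj (ns_sub x (na_mul u x))) eta (Sl _ _); apply.
  rewrite [X in _ * X * _](Si _ _).2 mulrAC ler_wpM2l ?(ltW xu)//.
  by rewrite mulr_ge0 ?(ns_norm_ge0 hY0).
Qed.

(** * Localisation of functionals by elements of the bidual *)

Section Amenable.
Context {X : bimod B} (hX : is_banach_bimodule S X).
Notation X' := (dual_bimod X).

Let n0 (a : B) : S a -> 0 <= ns_norm a.
Proof. by have [h _ _ _] := hS; exact: h. Qed.

Let Sl l (x : A l) : S (coord_inj x).
Proof. by have [_ h _ _] := hS; exact: (h l x).1. Qed.

(** Turns [xi] and [x] into a functional on [A l], to which an element of the bidual can be
    applied. *)
Lemma orbit_r_bdd l (xi : bfun X) (x : X) :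
  is_bdd_functional (fun c : A l => xi (bm_r x (coord_inj c : B))).
Proof.
have [xiD [xiZ _]] := bf_bdd xi; have [_ Si _ _] := hS.
have [M M0 hM] := bm_bound hX n0.
have [N N0 hN] := bdd_bound (bf_bdd xi) (ns_norm_ge0 (bm_space hX)).
split=> [c c'|]; first by rewrite (coord_injD hA (nrm := nrm)) (bm_rDr hX)// xiD.
split=> [k c|]; first by rewrite (coord_injZ hA (nrm := nrm)) (bm_rZr hX)// xiZ.
exists (N * (M * ns_norm x)) => c; apply: le_trans (hN _) _.
rewrite -mulrA ler_wpM2l// mulrAC -(Si l c).2.
by have [] := hM (coord_inj c) x (Sl c).
Qed.

Lemma orbit_l_bdd l (xi : bfun X) (x : X) :
  is_bdd_functional (fun c : A l => xi (bm_l (coord_inj c : B) x)).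
Proof.
have [xiD [xiZ _]] := bf_bdd xi; have [_ Si _ _] := hS.
have [M M0 hM] := bm_bound hX n0.
have [N N0 hN] := bdd_bound (bf_bdd xi) (ns_norm_ge0 (bm_space hX)).
split=> [c c'|]; first by rewrite (coord_injD hA (nrm := nrm)) (bm_lDl hX)// xiD.
split=> [k c|]; first by rewrite (coord_injZ hA (nrm := nrm)) (bm_lZl hX)// xiZ.
exists (N * (M * ns_norm x)) => c; apply: le_trans (hN _) _.
rewrite -mulrA ler_wpM2l// mulrAC -(Si l c).2.
by have [] := hM (coord_inj c) x (Sl c).
Qed.

(** Since [C] depends on [xi] alone, the tolerance for the approximate unit can be fixed before [x]
    varies. *)
Lemma orbit_bound (xi : bfun X) : exists2 C : R, 0 <= C & forall l (x : X),
  dual_norm (fun c : A l => xi (bm_r x (coord_inj c : B))) <= C * ns_norm x /\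
  dual_norm (fun c : A l => xi (bm_l (coord_inj c : B) x)) <= C * ns_norm x.
Proof.
have [_ Si _ _] := hS; have [M M0 hM] := bm_bound hX n0.
have [N N0 hN] := bdd_bound (bf_bdd xi) (ns_norm_ge0 (bm_space hX)).
have NM : 0 <= N * M by rewrite mulr_ge0.
exists (N * M) => // l x.
have NMx : 0 <= N * M * ns_norm x by rewrite mulr_ge0 ?(ns_norm_ge0 (bm_space hX)).
split; apply: (dual_norm_le (hA0 l)) => // c; apply: le_trans (hN _) _;
  rewrite -!mulrA ler_wpM2l// (mulrC (ns_norm x)) mulrA -(Si l c).2;
  by have [] := hM (coord_inj c) x (Sl c).
Qed.

Definition orbit_r l (xi : bfun X) (x : X) : dual_sp (A l) := BFun (orbit_r_bdd l xi x).
Definition orbit_l l (xi : bfun X) (x : X) : dual_sp (A l) := BFun (orbit_l_bdd l xi x).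

(** This functional is [E . xi], the substitute for [u . xi] when the unit lies in the bidual. *)
Lemma bidual_orbit_r_bdd l (E : bfun (dual_sp (A l))) (xi : bfun X) :
  is_bdd_functional (fun x => E (orbit_r l xi x)).
Proof.
have [ED [EZ _]] := bf_bdd E; have [xiD [xiZ _]] := bf_bdd xi.
have [C C0 hC] := orbit_bound xi.
have [N N0 hN] := bdd_bound (bf_bdd E) (ns_norm_ge0 (dual_banach (hA0 l))).
split=> [x y|].
  by rewrite -ED; congr (E _); apply: bfun_ext => c /=; rewrite (bm_rDl hX)// xiD.
split=> [k x|].
  by rewrite -EZ; congr (E _); apply: bfun_ext => c /=; rewrite (bm_rZl hX)// xiZ.
exists (N * C) => x; apply: le_trans (hN _) _; rewrite -mulrA ler_wpM2l//.
by have [] := hC l x.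
Qed.

Lemma bidual_orbit_l_bdd l (E : bfun (dual_sp (A l))) (xi : bfun X) :
  is_bdd_functional (fun x => E (orbit_l l xi x)).
Proof.
have [ED [EZ _]] := bf_bdd E; have [xiD [xiZ _]] := bf_bdd xi.
have [C C0 hC] := orbit_bound xi.
have [N N0 hN] := bdd_bound (bf_bdd E) (ns_norm_ge0 (dual_banach (hA0 l))).
split=> [x y|].
  by rewrite -ED; congr (E _); apply: bfun_ext => c /=; rewrite (bm_lDr hX)// xiD.
split=> [k x|].
  by rewrite -EZ; congr (E _); apply: bfun_ext => c /=; rewrite (bm_lZr hX)// xiZ.
exists (N * C) => x; apply: le_trans (hN _) _; rewrite -mulrA ler_wpM2l//.
by have [] := hC l x.
Qed.

(** The value of [b . (E . xi)] at [x] is [E] of [c |-> xi (x . (b c))], and [b c] involves only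
    [b l]. Closeness to [xi] on [s] is the unit property of [E], tested on the orbit of [x]. *)
Lemma dual_localize_l l : approx_semi_amenable (A l) setT ->
  forall (s : list (A l)) (xi : X') (e : R), 0 < e -> exists2 xi' : X',
     forall b, S b -> bm_l b xi' = bm_l (coord_inj (b l) : B) xi' &
     forall x, List.In x s ->
       ns_norm (ns_sub (bm_l (coord_inj x : B) xi) (bm_l (coord_inj x : B) xi')) < e.
Proof.
move=> hc s xi e e0; have [C C0 hC] := orbit_bound xi.
have [d d0 cd] := small_factor C0 e0.
have [E hE] := approx_semi_amenable_right_unit (hA l) hc s d0.
pose xi' : X' := BFun (bidual_orbit_r_bdd E xi).
exists xi' => [b Sb|a sa].
  apply: bfun_ext => x; rewrite !(dual_bm_lE hX n0)//=.
  congr (E _); apply: bfun_ext => c /=.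
  by rewrite -!(bm_rM hX)// !(mul_coord_inj hA) coord_inj_in.
apply: le_lt_trans cd.
apply: (dual_norm_le (bm_space hX)) => [|x]; first by rewrite mulr_ge0// ltW.
(* Multiplying the argument by [a] on the left turns the orbit of [x] into that of [x . a], which
   matches the form of [hE]. *)
have fE : to_bfun (fun b => (orbit_r l xi x : bfun (A l)) (na_mul a b)) =
    orbit_r l xi (bm_r x (coord_inj a : B)).
  have -> : (fun b => (orbit_r l xi x : bfun (A l)) (na_mul a b)) =
      orbit_r l xi (bm_r x (coord_inj a : B)) :> (A l -> Cx R).
    by apply/funext => c /=; rewrite (coord_injM hA (nrm := nrm)) (bm_rM hX).
  by apply: bfun_ext => c; rewrite to_bfunE//; exact: orbit_r_bdd.
change (cmod ((bm_l (coord_inj a : B) xi : bfun X) x -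
  (bm_l (coord_inj a : B) xi' : bfun X) x) <= C * d * ns_norm x).
rewrite !(dual_bm_lE hX n0)//= -fE.
apply: le_trans (hE a sa (orbit_r l xi x)) _; rewrite mulrC mulrAC ler_wpM2r ?(ltW d0)//.
by have [] := hC l x.
Qed.

Lemma dual_localize_r l : approx_semi_amenable (A l) setT ->
  forall (s : list (A l)) (xi : X') (e : R), 0 < e -> exists2 xi' : X',
     forall b, S b -> bm_r xi' b = bm_r xi' (coord_inj (b l) : B) &
     forall x, List.In x s ->
       ns_norm (ns_sub (bm_r xi (coord_inj x : B)) (bm_r xi' (coord_inj x : B))) < e.
Proof.
move=> hc s xi e e0; have [C C0 hC] := orbit_bound xi.
have [d d0 cd] := small_factor C0 e0.
have [E hE] := approx_semi_amenable_left_unit (hA l) hc s d0.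
pose xi' : X' := BFun (bidual_orbit_l_bdd E xi).
exists xi' => [b Sb|a sa].
  apply: bfun_ext => x; rewrite !(dual_bm_rE hX n0)//=.
  congr (E _); apply: bfun_ext => c /=.
  by rewrite -!(bm_lM hX)// !(coord_inj_mul hA) coord_inj_in.
apply: le_lt_trans cd.
apply: (dual_norm_le (bm_space hX)) => [|x]; first by rewrite mulr_ge0// ltW.
have fE : to_bfun (fun b => (orbit_l l xi x : bfun (A l)) (na_mul b a)) =
    orbit_l l xi (bm_l (coord_inj a : B) x).
  have -> : (fun b => (orbit_l l xi x : bfun (A l)) (na_mul b a)) =
      orbit_l l xi (bm_l (coord_inj a : B) x) :> (A l -> Cx R).
    by apply/funext => c /=; rewrite (coord_injM hA (nrm := nrm)) (bm_lM hX).
  by apply: bfun_ext => c; rewrite to_bfunE//; exact: orbit_l_bdd.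
change (cmod ((bm_r xi (coord_inj a : B) : bfun X) x -
  (bm_r xi' (coord_inj a : B) : bfun X) x) <= C * d * ns_norm x).
rewrite !(dual_bm_rE hX n0)//= -fE.
apply: le_trans (hE a sa (orbit_l l xi x)) _; rewrite mulrC mulrAC ler_wpM2r ?(ltW d0)//.
by have [] := hC l x.
Qed.

End Amenable.

(** [D] is bundled into a derivation [D'] with values in [dual_bimod X], so that the gluing theorem
    applies; the resulting net is then read back as functionals. *)
Theorem family_approx_semi_amenable :
  (forall l, approx_semi_amenable (A l) setT) -> approx_semi_amenable B S.
Proof.
move=> hc X hX D [Db [DD [DZ [DM Dc]]]]; have [n0 Si _ _] := hS.
have Sl l (x : A l) := (Si l x).1.
have hX' := dual_bimod_banach hX n0.
pose D' a : dual_bimod X := to_bfun (D a).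
have D'E a x : S a -> (D' a : bfun X) x = D a x.
  by move=> Sa; rewrite /D' to_bfunE//; exact: Db.
have hD' : is_cont_derivation S D'.
  split.
    move=> a b Sa Sb; have E : D (ns_add a b) = fun x => D a x + D b x.
      by apply/funext => x; rewrite DD.
    apply: bfun_ext => x; rewrite /D' E /= !to_bfunE//; try exact: Db.
    by apply: bdd_add; exact: Db.
  split.
    move=> k a Sa; have E : D (ns_scale k a) = fun x => k * D a x.
      by apply/funext => x; rewrite DZ.
    apply: bfun_ext => x; rewrite /D' E /= !to_bfunE//; try exact: Db.
    by apply: bdd_scale; exact: Db.
  split.
    move=> a b Sa Sb; have E : D (na_mul a b) = fun x => D b (bm_r x a) + D a (bm_l b x).
      by apply/funext => x; rewrite DM.
    have bb : is_bdd_functional (fun x => D b (bm_r x a))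
      by exact: (bm_bdd_r hX n0 Sa (Db _ Sb)).
    have ba : is_bdd_functional (fun x => D a (bm_l b x))
      by exact: (bm_bdd_l hX n0 Sb (Db _ Sa)).
    apply: bfun_ext => x; rewrite {1}/D' E to_bfunE; last exact: bdd_add.
    change (D b (bm_r x a) + D a (bm_l b x) =
      (bm_l a (D' b) : bfun X) x + (bm_r (D' a) b : bfun X) x).
    by rewrite (dual_bm_lE hX n0)// (dual_bm_rE hX n0)// !D'E.
  move=> a Sa e e0; have [d d0 hd] := Dc a Sa e e0; exists d => // b Sb ba.
  apply: le_lt_trans (hd b Sb ba); rewrite le_eqVlt; apply/orP; left; apply/eqP.
  by congr dual_norm; apply/funext => x /=; rewrite -!D'E.
have [|||I [le [xi [eta [dle h]]]]] := family_approx_semi_inner hA hS hX' hD'.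
- move=> l s e e0.
  (* Restricting [X] to [A l] leaves its dual space unchanged, so the functionals found for [A l]
     can be used as they stand. *)
  have [|I [le [xi [eta [dle [bxi [beta h]]]]]]] :=
      hc l _ (res_bimod_banach hA hS l hX) (fun a => D (coord_inj a)).
    split; first by move=> a _; exact: Db.
    split; first by move=> a b x _ _; rewrite (coord_injD hA (nrm := nrm)) DD.
    split; first by move=> k a x _; rewrite (coord_injZ hA (nrm := nrm)) DZ.
    split; first by move=> a b x _ _; rewrite (coord_injM hA (nrm := nrm)) DM.
    move=> a _ d d0; have [c c0 hc'] := Dc _ (Sl l a) d d0.
    exists c => // b _ ba; apply: hc'; first exact: Sl.
    by rewrite -(coord_injB hA) /= (Si _ _).2.
  have [i hi] := net_list dle (fun a => h a Logic.I) s e0.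
  exists (BFun (bxi i)), (BFun (beta i)) => a /hi; apply: le_lt_trans.
  rewrite le_eqVlt; apply/orP; left; apply/eqP; congr dual_norm; apply/funext => x.
  by rewrite (dual_semi_innerE hX n0)// D'E.
- by move=> l; exact: dual_localize_l.
- by move=> l; exact: dual_localize_r.
exists I, le, (fun i => xi i : bfun X), (fun i => eta i : bfun X).
split=> //; split; first by move=> i; exact: bf_bdd.
split; first by move=> i; exact: bf_bdd.
move=> a Sa e e0; have [i hi] := h a Sa e e0; exists i => j /hi.
congr (`| _ | < _); congr dual_norm; apply/funext => x.
by rewrite (dual_semi_innerE hX n0)// D'E.
Qed.

End FamilyPermanence.

(** * Finite restrictions in the two sequence algebras *)

Lemma esum_tail {R : realType} {L : choiceType} (t : L -> R) (d : R) :
  (forall l, 0 <= t l) -> (\esum_(l in setT) (t l)%:E < +oo)%E -> 0 < d ->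
  exists F : seq L, forall G : seq L, {subset F <= G} ->
    (\esum_(l in ~` [set` G]) (t l)%:E < d%:E)%E.
Proof.
move=> t0 tfin d0.
have t0E l : (0 <= (t l)%:E)%E by rewrite lee_fin.
have tf : (\esum_(l in setT) (t l)%:E)%E \is a fin_num.
  by rewrite ge0_fin_numE// esum_ge0.
(* The total is a supremum of finite sums, so some finite sum comes within [d] of it. *)
have [_ [X [/finite_seqP[F ->] _] <-] hX] := ub_ereal_sup_adherent d0 tf.
exists F => G FG; have FGs : (\sum_(x \in [set` F]) (t x)%:E <=
    \esum_(l in [set` G]) (t l)%:E)%E.
  by apply: esum_ge; exists [set` F] => //; split.
(* The total splits into the sums over [G] and its complement; cancelling the finite sum over [G]
   leaves the tail below [d]. *)
have := esumID [set` G] setT (fun l => (t l)%:E) (fun l _ => t0E l).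
rewrite !setTI => E; move: (tf); rewrite E fin_numD => /andP[fG fC].
have := lt_le_trans hX FGs; rewrite -/(esum _ _) E.
by rewrite lteBlDr// lteD2lE.
Qed.

Section SequenceAlgebras.
Context {R : realType} {L : choiceType} {A : L -> nalg R}.
Context (hA : forall l, is_banach_algebra (A l) setT).

Let hA0 l : @is_banach_space R (A l) setT. Proof. by case: (hA l). Qed.
Let n0 l (x : A l) : 0 <= ns_norm x. Proof. exact: ns_norm_ge0. Qed.

Lemma norm_coord_inj l (x : A l) m :
  ns_norm (coord_inj x m) = if m == l then ns_norm x else 0.
Proof.
have [->|ml] := eqVneq m l; first by rewrite coord_inj_in.
by rewrite coord_inj_out 1?eq_sym// ns_norm0.
Qed.

Lemma norm_restrict F (a : forall m, A m) m :
  ns_norm (fam_restrict F a m) = if m \in F then ns_norm (a m) else 0.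
Proof. by rewrite /fam_restrict; case: ifP => // _; rewrite ns_norm0. Qed.

Lemma norm_sub_restrict nrm F (a : forall m, A m) m :
  ns_norm (@ns_sub R (@fam_alg R L A nrm) (fam_restrict F a) a m) =
  if m \in F then 0 else ns_norm (a m).
Proof.
rewrite /ns_sub /= /fam_restrict; case: ifP => _.
  by rewrite (ns_addN (hA0 m)) ns_norm0.
by rewrite (ns_add0 (hA0 m)) (ns_normN (hA0 m)).
Qed.

Lemma c0_restriction_dense : is_restriction_dense (c0_set A).
Proof.
split.
- move=> a _; rewrite /c0_norm.
  (* [sup] is 0 by convention on a set that is empty or unbounded above. *)
  have [hs|hs] := pselect (has_sup [set ns_norm (a l) | l in setT]); last first.
    by rewrite sup_out.
  have [[y [l _ _]] _] := hs; apply: le_trans (n0 (a l)) _.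
  by apply: sup_upper_bound => //; exists l.
- move=> l x; split.
    move=> e e0; apply: (@sub_finite_set _ _ [set l]); last exact: finite_set1.
    move=> m /=; rewrite norm_coord_inj; case: eqP => // _.
    by rewrite leNgt e0.
  rewrite /c0_norm; set E := [set _ | _ in _].
  have Ex : E (ns_norm x) by exists l => //; rewrite coord_inj_in.
  have ubE : ubound E (ns_norm x).
    by move=> _ [m _ <-]; rewrite norm_coord_inj; case: ifP.
  apply/eqP; rewrite eq_le; apply/andP; split.
    by apply: ge_sup => //; exists (ns_norm x).
  by apply: ub_le_sup => //; exists (ns_norm x).
- move=> F a Sa e e0; apply: sub_finite_set (Sa e e0) => m /=.
  by rewrite norm_restrict; case: ifP => // _; rewrite leNgt e0.
- move=> a Sa d d0; have d20 : 0 < d / 2 by rewrite divr_gt0.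
  (* [F] lists the coordinates of norm at least [d / 2]; the halving keeps the supremum of the
     others strictly below [d]. *)
  have /finite_seqP[F hF] := Sa _ d20; exists F => G FG.
  rewrite /c0_norm; set E := [set _ | _ in _].
  (* The index type may be empty. *)
  have [E0|/set0P nE] := eqVneq E set0; first by rewrite E0 sup0.
  apply: (@le_lt_trans _ _ (d / 2)); last by lra.
  apply: ge_sup => // _ [m _ <-]; rewrite norm_sub_restrict; case: ifPn => [_|mG].
    exact: ltW.
  rewrite leNgt; apply/negP => /ltW dm; move/negP: mG; apply; apply: FG.
  by have : [set` F] m by rewrite -hF.
Qed.

Lemma lp_restriction_dense (p : R) : 1 <= p -> is_restriction_dense (lp_set A p).
Proof.
move=> p1; have p0 : 0 < p by lra.
(* Ensures that the power of 0 is 0, so vanishing coordinates contribute nothing to the sum. *)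
have pN0 : p != 0 by rewrite gt_eqF.
have powK (r : R) : 0 <= r -> (r `^ p) `^ p^-1 = r.
  by move=> r0; rewrite -powRrM divff// powRr1.
split.
- by move=> a _; exact: powR_ge0.
- move=> l x.
  have E : lp_sum p (coord_inj x) = ((ns_norm x) `^ p)%:E.
    rewrite /lp_sum (eq_esum (b := fun m =>
      if m \in [set l] then ((ns_norm x) `^ p)%:E else 0%E)).
      by rewrite -esum_mkcond esum_set1// lee_fin powR_ge0.
    move=> m _; rewrite norm_coord_inj; have [->|ml] := eqVneq m l.
      by rewrite ifT// inE.
    by rewrite powR0// ifF//; apply/negbTE; rewrite notin_setE /=; apply/eqP.
  by rewrite /lp_set/= /lp_norm E ltry; split=> //=; rewrite powK.
- move=> F a; rewrite /lp_set/=; apply: le_lt_trans.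
  apply: le_esum => m _; rewrite lee_fin norm_restrict; case: ifP => // _.
  by rewrite powR0// powR_ge0.
(* The tail is cut at the [p]-th power of [d], because the norm takes a [p]-th root. *)
- move=> a Sa d d0; have dp0 : 0 < d `^ p by rewrite powR_gt0.
  have [F hF] := esum_tail (fun l => powR_ge0 (ns_norm (a l)) p) Sa dp0.
  exists F => G /hF hG.
  set b := ns_sub _ _.
  have E : lp_sum p b = (\esum_(l in ~` [set` G]) (ns_norm (a l) `^ p)%:E)%E.
    rewrite /lp_sum [RHS]esum_mkcond; apply: eq_esum => m _.
    rewrite norm_sub_restrict in_setC mem_setE; case: ifP => //= _.
    by rewrite powR0.
  have E0 : (0 <= lp_sum p b)%E.
    by apply: esum_ge0 => m _; rewrite lee_fin powR_ge0.
  rewrite -E in hG; rewrite /lp_norm -[ltRHS](powK _ (ltW d0)).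
  have bf : lp_sum p b \is a fin_num by rewrite ge0_fin_numE// (lt_trans hG)// ltry.
  apply: gt0_ltr_powR; rewrite ?invr_gt0 ?nnegrE ?fine_ge0 ?(ltW dp0)//.
  by rewrite -lte_fin fineK.
Qed.

End SequenceAlgebras.

Theorem theorem5p4 (R : realType) (L : choiceType) (A : L -> nalg R) :
  (forall l, is_banach_algebra (A l) setT) ->
  ((forall l, approx_semi_contractible (A l) setT) ->
     (forall p : R, 1 <= p -> approx_semi_contractible (lp_alg A p) (lp_set A p)) /\
     approx_semi_contractible (c0_alg A) (c0_set A)) /\
  ((forall l, approx_semi_amenable (A l) setT) ->
     (forall p : R, 1 <= p -> approx_semi_amenable (lp_alg A p) (lp_set A p)) /\
     approx_semi_amenable (c0_alg A) (c0_set A)).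
Proof.
move=> hA; split=> h; split.
- move=> p p1; exact: (family_approx_semi_contractible hA (lp_restriction_dense hA p1) h).
- exact: (family_approx_semi_contractible hA (c0_restriction_dense hA) h).
- move=> p p1; exact: (family_approx_semi_amenable hA (lp_restriction_dense hA p1) h).
- exact: (family_approx_semi_amenable hA (c0_restriction_dense hA) h).
Qed.
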